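(* Let $B\subset\mathbb{R}^2$ be a body with piecewise-algebraic boundary, and suppose that the complexifications in $\mathbb{CP}^2$ of the algebraic pieces of the boundary contain neither of the isotropic points at infinity $I_1=(1:i:0)$, $I_2=(1:-i:0)$. Then for every odd $k$ the body $B$ is not $k$-reflective.
   Context: $\mathbb{R}^2\subset\mathbb{C}^2\subset\mathbb{CP}^2$ in the standard way. The boundary is piecewise-algebraic if it consists of finitely many arcs (''pieces'') of real planar algebraic curves; the complexification of a piece is the complex projective algebraic curve in $\mathbb{CP}^2$ containing it (the Zariski closure of the piece). A body $B\subset\mathbb{R}^2$ is a (possibly disconnected) closed bounded perfectly reflecting set. For an oriented line $R$, take its first intersection point $A_1$ with the boundary $\partial B$ and reflect $R$ from the tangent line $T_{A_1}\partial B$ by the usual reflection law (angle of incidence equals angle of reflection). The reflected ray issues from $A_1$ and defines a new oriented line; the procedure is then repeated (first next intersection point of the reflected ray with $\partial B$, reflection there, and so on). If after a finite number $k$ of reflections the output oriented line coincides with the input oriented line $R$ and does not hit the body any more, then $B$ is said to be invisible in the direction $R$, and $R$ is called an invisibility direction with $k$ reflections. A body $B$ with piecewise-smooth boundary is called $k$-reflective if the set of its invisibility directions with $k$ reflections has positive measure (in the two-dimensional space of oriented lines in $\mathbb{R}^2$ with its natural measure). *)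

(* Defs.v *)
From mathcomp Require Import all_boot all_order all_algebra.
From mathcomp Require Import all_classical all_reals all_analysis.
From mathcomp Require Import complex.
(* The notations of mpoly clash with those of MathComp-Analysis. *)
From mathcomp Require Import -(notations) mpoly.
Set Implicit Arguments.
Unset Strict Implicit.
Unset Printing Implicit Defensive.
Import Order.TTheory GRing.Theory Num.Theory.
Import numFieldNormedType.Exports.
Local Open Scope classical_set_scope.
Local Open Scope ring_scope.

Definition dot (R : realType) (u v : R * R) : R := u.1 * v.1 + u.2 * v.2.

Definition cross (R : realType) (u v : R * R) : R := u.1 * v.2 - u.2 * v.1.

Definition boundary (T : topologicalType) (B : set T) : set T :=
  closure B `\` interior B.

Definition is_arc (R : realType) (G : set (R * R)) : Prop :=
  exists g : R -> R * R,
    [/\ {within `[0, 1], continuous g},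
        set_inj `[0, 1] g
      & G = g @` `[0, 1]].

Definition on_real_algebraic_curve (R : realType) (G : set (R * R)) : Prop :=
  exists2 P : mpoly.mpoly 2 R, P != 0 &
    forall x, G x -> mpoly.meval (tnth [tuple x.1; x.2]) P = 0.

Definition algebraic_arc (R : realType) (G : set (R * R)) : Prop :=
  is_arc G /\ on_real_algebraic_curve G.

(* Points of the complex projective plane are given by nonzero triples of
   homogeneous coordinates; (x, y) in the real plane is (x : y : 1). *)
Definition affine_point (R : realType) (x : R * R) : 3.-tuple R[i] :=
  [tuple (x.1)%:C%C; (x.2)%:C%C; 1].

(* Zariski closure in the complex projective plane: the common zeros of all
   homogeneous polynomials vanishing on G. *)
Definition complexification (R : realType) (G : set (R * R)) :
    set (3.-tuple R[i]) :=
  [set z | (exists j, tnth z j != 0) /\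
     forall (d : nat) (F : mpoly.mpoly 3 R[i]),
       F \is mpoly.ishomog1 d (@mpoly.mdeg 3) ->
       (forall x, G x -> mpoly.meval (tnth (affine_point x)) F = 0) ->
       mpoly.meval (tnth z) F = 0].

Definition isotropic1 (R : realType) : 3.-tuple R[i] := [tuple 1; 'i%C; 0].

Definition isotropic2 (R : realType) : 3.-tuple R[i] := [tuple 1; - 'i%C; 0].

(* tau spans the tangent line to S at a, i.e. the limit of the secants a p as
   p tends to a in S: the distance from p to the line a + R tau is
   o(|p - a|). *)
Definition tangent_vector (R : realType) (S : set (R * R)) (a tau : R * R) :
    Prop :=
  [/\ tau != 0, limit_point S a &
      (fun p : R * R => cross (p - a) tau / `|p - a|) @ within S a^' --> (0 : R)].

(* The symmetric image of u with respect to the line spanned by tau. *)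
Definition mirror (R : realType) (tau u : R * R) : R * R :=
  (2 * dot u tau / dot tau tau) *: tau - u.

Definition reflects (R : realType) (S : set (R * R)) (a u v : R * R) : Prop :=
  exists2 tau, tangent_vector S a tau & v = mirror tau u.

Definition first_hit (R : realType) (S : set (R * R)) (p u a : R * R) : Prop :=
  exists t : R, [/\ a = p + t *: u, S a & forall s, s < t -> ~ S (p + s *: u)].

Definition next_hit (R : realType) (S : set (R * R)) (p u a : R * R) : Prop :=
  exists t : R,
    [/\ 0 < t, a = p + t *: u, S a &
        forall s, 0 < s -> s < t -> ~ S (p + s *: u)].

(* The oriented line l = (theta, r), with 0 <= theta < 2 pi and r real, has
   direction (cos theta, sin theta) and signed distance r to the origin; every
   oriented line is obtained exactly once, and the natural (motion-invariant)
   measure is dtheta dr. *)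
Definition oriented_lines (R : realType) : set (R * R) :=
  [set l | 0 <= l.1 /\ l.1 < 2 * pi].

Definition line_dir (R : realType) (l : R * R) : R * R := (cos l.1, sin l.1).

Definition line_base (R : realType) (l : R * R) : R * R :=
  (- (l.2 * sin l.1), l.2 * cos l.1).

Definition line_measure (R : realType) :
    set (measurableTypeR R * measurableTypeR R) -> \bar R :=
  (@lebesgue_measure R \x @lebesgue_measure R)%E.

(* a 0, ..., a k.-1 are the successive reflection points off S of the input
   line l, u 0 is the direction of l and u i.+1 is the direction after the
   reflection at a i. *)
Definition billiard_orbit (R : realType) (S : set (R * R)) (k : nat)
    (l : R * R) (a u : nat -> R * R) : Prop :=
  [/\ u 0%N = line_dir l,
      first_hit S (line_base l) (u 0%N) (a 0%N),
      forall i, (i < k)%N -> reflects S (a i) (u i) (u i.+1)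
    & forall i, (i.+1 < k)%N -> next_hit S (a i) (u i.+1) (a i.+1)].

(* The oriented line through p with unit direction u coincides with l. *)
Definition on_oriented_line (R : realType) (l p u : R * R) : Prop :=
  u = line_dir l /\ exists t : R, p = line_base l + t *: line_dir l.

Definition invisibility_direction (R : realType) (B : set (R * R)) (k : nat)
    (l : R * R) : Prop :=
  (0 < k)%N /\
  exists a u : nat -> R * R,
    [/\ billiard_orbit (boundary B) k l a u,
        on_oriented_line l (a k.-1) (u k)
      & forall t : R, 0 < t -> ~ B (a k.-1 + t *: u k)].

(* Positive (outer) measure: the set of invisibility directions lies in no
   measurable set of measure zero, so no measurability is assumed. *)
Definition k_reflective (R : realType) (k : nat) (B : set (R * R)) : Prop :=
  ~ (@line_measure R).-negligible
      (@oriented_lines R `&` invisibility_direction B k).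

(* Main.v *)
Require Import Defs.
From HB Require Import structures.
From mathcomp Require Import all_boot all_order all_algebra.
From mathcomp Require Import all_classical all_reals all_analysis.
From mathcomp Require Import measurable_realfun complex.
From mathcomp Require Import -(notations) mpoly.
From mathcomp Require Import ring lra.
Set Implicit Arguments.
Unset Strict Implicit.
Unset Printing Implicit Defensive.
Import Order.TTheory GRing.Theory Num.Theory.
Import numFieldNormedType.Exports.
Local Open Scope classical_set_scope.
Local Open Scope ring_scope.

(** In the isotropic coordinates z = x + i y and w = x - i y an oriented line
    whose unit direction is the complex number q has an equation
    z - q^2 w = c, and the reflection at a point with tangent vector tau turns
    q into m / q, where m = tau_z / tau_w.  If q were infinitely small and m a
    unit, the reflected q would be infinitely large, the next one infinitely
    small again, and after an odd number of reflections the line could not be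
    the initial one.  Real lines have |q| = 1, so infinitely small is
    understood with respect to a valuation of the field of complex numbers.

    Each arc lies on the zero sets of two homogeneous forms, one nonzero at the
    first isotropic point at infinity and one nonzero at the second.  Let k be a
    countable subfield of the complex numbers that contains i and the
    coefficients of these forms.  The lines
    for which q and c are algebraically dependent over k form a countable
    union of null sets ([generic_line]).  For every other line there is a
    valuation ring V that contains the field k(c) and has q in its maximal
    ideal, by the extension theorem of Chevalley ([generic_place]).  In terms
    of V the line is infinitely close to an isotropic line z = c which is
    generic over k.

    The invariant of the orbit is [near_isotropic]: the line is infinitely
    close to a line z = const or w = const, alternately, with a constant whose
    residue is transcendental over k.  A form that is nonzero at the isotropic
    point keeps the hit point at finite distance, so that the hit point has
    finite coordinates with transcendental residues ([isotropic_step]).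
    Elements that are algebraic over k(z) then are zero or units of V.  The
    tangent slope m is such an element: a polynomial Q over k of minimal degree
    in w that vanishes at the hit point also vanishes on the arc near that point
    ([min_relation]), its gradient there is nonzero, and the gradient is
    orthogonal to the tangent ([tangent_gradient]).  Hence m is a unit and the
    invariant passes to the reflected line with z and w exchanged. *)

(** * Subfields and valuation rings *)

Record subfield (K : fieldType) := Subfield {
  sf_set :> K -> Prop;
  sf_1 : sf_set 1;
  sf_B : forall x y, sf_set x -> sf_set y -> sf_set (x - y);
  sf_div : forall x y, sf_set x -> sf_set y -> sf_set (x / y) }.

(** A subfield as a type: it provides polynomial rings, pseudo-division and
    integral elements over the subfield. *)
Definition sf_pred (K : fieldType) (S : subfield K) : {pred K} :=
  fun x => `[< sf_set S x >].

Lemma sf_pred_closed (K : fieldType) (S : subfield K) :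
  divring_closed (sf_pred S).
Proof.
by split=> [|x y|x y]; rewrite !unfold_in /sf_pred; first exact/asboolP/sf_1;
  move=> /asboolP Sx /asboolP Sy; apply/asboolP; [exact: sf_B|exact: sf_div].
Qed.

HB.instance Definition _ (K : fieldType) (S : subfield K) :=
  GRing.isDivringClosed.Build K (sf_pred S) (sf_pred_closed S).

Record sf_type (K : fieldType) (S : subfield K) :=
  SfType { sf_val :> K; sf_valP : sf_val \in sf_pred S }.

HB.instance Definition _ (K : fieldType) (S : subfield K) :=
  [isSub for (@sf_val K S)].
HB.instance Definition _ (K : fieldType) (S : subfield K) :=
  [Choice of sf_type S by <:].
HB.instance Definition _ (K : fieldType) (S : subfield K) :=
  [SubChoice_isSubIntegralDomain of sf_type S by <:].
HB.instance Definition _ (K : fieldType) (S : subfield K) :=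
  [SubIntegralDomain_isSubField of sf_type S by <:].

Definition sf_emb (K : fieldType) (S : subfield K) : {rmorphism sf_type S -> K} := val.

Lemma sf_lift (K : fieldType) (S : subfield K) x :
  S x -> exists y : sf_type S, val y = x.
Proof.
by move=> Sx; have Sx' : x \in sf_pred S by [apply/asboolP]; exists (SfType Sx').
Qed.

Lemma sf_setP (K : fieldType) (S : subfield K) (y : sf_type S) : S (val y).
Proof. by case: y => x /= /asboolP. Qed.

Record valuation_ring (K : fieldType) := ValuationRing {
  vr_set :> K -> Prop;
  vr_1 : vr_set 1;
  vr_B : forall x y, vr_set x -> vr_set y -> vr_set (x - y);
  vr_M : forall x y, vr_set x -> vr_set y -> vr_set (x * y);
  vr_or : forall x, vr_set x \/ vr_set x^-1 }.

Section ValuationTheory.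
Variables (K : fieldType) (V : valuation_ring K).
Implicit Types (x y : K).

Lemma vr_0 : V 0. Proof. by rewrite -(subrr 1); apply: vr_B; apply: vr_1. Qed.
Lemma vr_N x : V x -> V (- x).
Proof. by move=> Vx; rewrite -sub0r; apply: vr_B => //; apply: vr_0. Qed.
Lemma vr_D x y : V x -> V y -> V (x + y).
Proof. by move=> Vx Vy; rewrite -[y]opprK; apply: vr_B => //; apply: vr_N. Qed.
Lemma vr_X x n : V x -> V (x ^+ n).
Proof.
by move=> Vx; elim: n => [|n IH]; [apply: vr_1 | rewrite exprS; apply: vr_M].
Qed.

(** The maximal ideal, that is, the infinitely small elements. *)
Definition vr_max x := x = 0 \/ ~ V x^-1.

Lemma vr_max_sub x : vr_max x -> V x.
Proof. by case=> [->|nVx]; [apply: vr_0 | have [] := vr_or V x]. Qed.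

Lemma vr_max0 : vr_max 0. Proof. by left. Qed.

Lemma vr_max1 : ~ vr_max 1.
Proof. by case=> [/eqP|]; [rewrite oner_eq0|rewrite invr1; apply; apply: vr_1]. Qed.

Lemma vr_maxM x y : V x -> vr_max y -> vr_max (x * y).
Proof.
move=> Vx [->|nVy]; first by rewrite mulr0; left.
have [->|x0] := eqVneq x 0; first by rewrite mul0r; left.
right; rewrite invfM => Vxy; apply: nVy.
by rewrite -[y^-1](mulVKf x0); apply: vr_M.
Qed.

Lemma vr_maxN x : vr_max x -> vr_max (- x).
Proof. by rewrite -mulN1r; apply: vr_maxM; apply: vr_N; apply: vr_1. Qed.

Lemma vr_unit x : V x -> ~ vr_max x -> x != 0 /\ V x^-1.
Proof.
by move=> Vx /not_orP[/eqP x0 /contrapT].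
Qed.

Lemma vr_max_inv x : vr_max x -> V x^-1 -> x = 0.
Proof. by case. Qed.

Lemma vr_maxD x y : vr_max x -> vr_max y -> vr_max (x + y).
Proof.
wlog Vxy : x y / V (x / y) => [hw|] Mx My.
  have [/hw|] := vr_or V (x / y); first exact.
  by rewrite invf_div addrC => /hw; apply.
have [->|y0] := eqVneq y 0; first by rewrite addr0.
have -> : x + y = (x / y + 1) * y by rewrite mulrDl mul1r divfK.
by apply: vr_maxM => //; apply: vr_D => //; apply: vr_1.
Qed.

Lemma vr_unitD x y : V x^-1 -> x != 0 -> vr_max y -> x + y != 0 /\ V (x + y)^-1.
Proof.
move=> Vx x0 My.
have -> : x + y = x * (1 + x^-1 * y) by rewrite mulrDr mulr1 mulVKf.
have My' : vr_max (x^-1 * y) by apply: vr_maxM.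
have [|e1 e2] := @vr_unit (1 + x^-1 * y) (vr_D (vr_1 V) (vr_max_sub My')).
  move=> /vr_maxD/(_ (vr_maxN My')); rewrite addrK; exact: vr_max1.
by rewrite mulf_neq0 // invfM; split=> //; apply: vr_M.
Qed.

(** Divide an equation of integral dependence of [x] by the top power of [x]:
    if [x] were infinitely large, 1 would be infinitely small. *)
Lemma vr_integrally_closed (p : {poly K}) x :
  (forall i, V p`_i) -> p \is monic -> root p x -> V x.
Proof.
move=> Vp /monicP mp px; apply: contrapT => nVx.
have x0 : x != 0 by apply/eqP => x0; apply: nVx; rewrite x0; apply: vr_0.
have Mx : vr_max x^-1 by right; rewrite invrK.
have p0 : p != 0.
  by apply/eqP => p0; move: mp; rewrite p0 lead_coef0 => /eqP; rewrite eq_sym oner_eq0.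
apply: vr_max1.
case sp : (size p) => [|n]; first by move/eqP: sp; rewrite size_poly_eq0 (negPf p0).
have /eqP : \sum_(i < n.+1) p`_i * x ^+ i = 0.
  by move/rootP: px; rewrite horner_coef sp.
have lp : p`_n = 1 by rewrite -mp /lead_coef sp.
rewrite big_ord_recr /= lp mul1r addrC addr_eq0 => /eqP e.
have -> : 1 = - (\sum_(i < n) p`_i * x ^+ i) * (x ^+ n)^-1.
  by rewrite -e divff // expf_neq0.
rewrite mulNr; apply: vr_maxN; rewrite mulr_suml; apply: (big_ind vr_max) => //.
- exact: vr_max0.
- exact: vr_maxD.
move=> i _; rewrite -mulrA; apply: vr_maxM => //.
have -> : x ^+ i / x ^+ n = x^-1 ^+ (n - i).-1 * x^-1.
  have lt_in := ltn_ord i; rewrite -exprSr prednK ?subn_gt0 // exprVn.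
  by rewrite expfB_cond ?(negPf x0) ?invf_div // ltnW.
by apply: vr_maxM => //; apply: vr_X; apply: vr_max_sub.
Qed.

Lemma vr_integral (S : subfield K) x : (forall y, S y -> V y) ->
  integralOver (val : sf_type S -> K) x -> V x.
Proof.
move=> SV [p mp px]; apply: vr_integrally_closed px; last exact: monic_map.
by move=> i; rewrite coef_map; apply: SV; apply: sf_setP.
Qed.

Lemma vr_integral_inv (S : subfield K) x : (forall y, S y -> V y) ->
  integralOver (val : sf_type S -> K) x -> V x^-1.
Proof. by move=> SV /(integral_inv); apply: vr_integral. Qed.

End ValuationTheory.

(** * The extension theorem of Chevalley *)

Section Chevalley.
Variables (K : fieldType) (q : K) (q0 : q != 0).

Definition is_subring (A : set K) :=
  [/\ A 1, forall x y, A x -> A y -> A (x - y) & forall x y, A x -> A y -> A (x * y)].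

Lemma subring_add A x y : is_subring A -> A x -> A y -> A (x + y).
Proof.
move=> [A1 AB _] Ax Ay; rewrite -[y]opprK -[- y]sub0r -(subrr 1).
by apply: (AB) => //; apply: (AB) => //; apply: (AB).
Qed.

Lemma subring_exp A x n : is_subring A -> A x -> A (x ^+ n).
Proof.
by move=> [A1 _ AM] Ax; elim: n => [|n IH] //; rewrite exprS; apply: AM.
Qed.

Lemma subring_sum A n (F : 'I_n -> K) :
  is_subring A -> (forall i, A (F i)) -> A (\sum_i F i).
Proof.
move=> sA AF; apply: (big_ind A) => //; last by move=> x y; apply: subring_add.
by case: sA => A1 AB _; rewrite -(subrr 1); apply: AB.
Qed.

Definition adjoin (A : set K) x : set K :=
  [set y | exists2 p : {poly K}, (forall i, A p`_i) & y = p.[x]].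

Lemma adjoin_subring A x : is_subring A -> is_subring (adjoin A x).
Proof.
move=> sA; have [A1 AB AM] := sA.
have A0 : A 0 by rewrite -(subrr 1); apply: AB.
split=> [|_ _ [p Ap ->] [r Ar ->]|_ _ [p Ap ->] [r Ar ->]].
- by exists 1; rewrite ?hornerC // => i; rewrite coef1; case: (i == 0%N).
- by exists (p - r); rewrite ?hornerD ?hornerN // => i; rewrite coefB; apply: AB.
- exists (p * r); rewrite ?hornerM // => i; rewrite coefM.
  by apply: subring_sum => // j; apply: AM.
Qed.

Lemma adjoin_sub A x y : is_subring A -> A y -> adjoin A x y.
Proof.
move=> [A1 AB AM] Ay; exists y%:P; rewrite ?hornerC // => i.
by rewrite coefC; case: (i == 0%N) => //; rewrite -(subrr 1); apply: AB.
Qed.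

Lemma adjoin_gen A x : is_subring A -> adjoin A x x.
Proof.
move=> [A1 AB AM]; exists 'X; rewrite ?hornerX // => i.
have A0 : A 0 by rewrite -(subrr 1); apply: AB.
by rewrite coefX; case: (i == 1%N).
Qed.

(** Relations [q p(x) = 1] and [q r(1/x) = 1] with coefficients in [A] shorten
    each other: as [1 - q r_0] is a unit, the second one expresses 1 by
    negative powers of [x], and this replaces the top power of [x] in the
    first one by lower powers. *)
Lemma no_relation_of_inverses (A : set K) : is_subring A -> A q ->
    (forall a, A a -> A (1 - q * a)^-1) -> ~ A q^-1 ->
  forall N x (p r : {poly K}), (size p + size r <= N)%N ->
    (forall i, A p`_i) -> (forall i, A r`_i) ->
    q * p.[x] = 1 -> q * r.[x^-1] = 1 -> False.
Proof.
move=> sA Aq AU nAq; have [A1 AB AM] := sA.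
have A0 : A 0 by rewrite -(subrr 1); apply: AB.
have noC (p : {poly K}) x : (forall i, A p`_i) -> (size p <= 1)%N ->
    q * p.[x] = 1 -> False.
  move=> Ap /size1_polyC ->; rewrite hornerC => e; apply: nAq.
  have -> : q^-1 = p`_0 by rewrite -[LHS]mulr1 -e mulKf.
  exact: Ap.
elim=> [|N IH] x p r.
  rewrite leqn0 addn_eq0 size_poly_eq0 => /andP[/eqP-> _] _ _.
  by rewrite horner0 mulr0 => /eqP; rewrite eq_sym oner_eq0.
wlog le_rp : x p r / (size r <= size p)%N.
  move=> hw s Ap Ar ep er; case: (leqP (size r) (size p)) => [le|/ltnW le].
    exact: (hw x p r).
  by apply: (hw x^-1 r p) => //; rewrite ?invrK // addnC.
move=> s Ap Ar ep er.
have [x0|x0] := eqVneq x 0.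
  apply: (noC (p`_0)%:P x); rewrite ?size_polyC ?leq_b1 //.
    by move=> i; rewrite coefC; case: (i == 0%N).
  by rewrite hornerC -horner_coef0 -x0.
case sp : (size p) => [|[|n]]; first by apply: (noC p x) => //; rewrite sp.
  by apply: (noC p x) => //; rewrite sp.
set u := (1 - q * r`_0)^-1.
have Au : A u by apply: AU.
have u0 : 1 - q * r`_0 != 0.
  apply/eqP => /eqP; rewrite subr_eq0 => /eqP e; apply: nAq.
  have -> : q^-1 = r`_0 by rewrite -[LHS]mulr1 e mulKf.
  exact: Ar.
(* This is p with x ^ n.+1 replaced by the combination of lower powers that
   the relation for r gives. *)
pose t := \poly_(i < n.+1) (p`_i + p`_n.+1 * (q * u * r`_(n.+1 - i))).
have At i : A t`_i.
  rewrite coef_poly; case: ifP => // _; apply: subring_add => //.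
  by do ![apply: (AM) => //].
apply: (IH x t r) => //.
  apply: leq_trans (_ : n.+1 + size r <= N)%N; first by rewrite leq_add2r size_poly.
  by rewrite sp addSn ltnS in s.
rewrite -ep; congr (q * _).
rewrite horner_poly [in RHS]horner_coef sp [in RHS]big_ord_recr /=.
under eq_bigr do rewrite mulrDl; rewrite big_split /=; congr (_ + _).
under eq_bigr do rewrite -mulrA; rewrite -mulr_sumr; congr (_ * _).
have er' : 1 - q * r`_0 = q * \sum_(i < n.+1) r`_i.+1 * x^-1 ^+ i.+1.
  rewrite -er (@horner_coef_wide _ n.+2); last by rewrite -sp.
  by rewrite big_ord_recl expr0 mulr1 mulrDr addrC addKr.
have -> : x ^+ n.+1 = u * (1 - q * r`_0) * x ^+ n.+1 by rewrite mulVf ?mul1r.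
rewrite er' mulrA [u * q]mulrC -mulrA mulr_suml mulr_sumr (reindex_inj rev_ord_inj) /=.
apply: eq_bigr => i _; rewrite -!mulrA; congr (_ * (_ * (_ * _))).
  by rewrite subKn ?ltn_ord.
rewrite exprVn subSS -[X in _ = _ * x ^+ X](@subnK (i.+1) n.+1) // exprD mulrCA.
by rewrite mulVf ?expf_neq0 ?mulr1 // subSS.
Qed.

(** A subring that is maximal among those containing [A] but not [1/q] is a
    valuation ring: if neither [x] nor [1/x] belongs to it, adjoining either
    of them produces [1/q], which [no_relation_of_inverses] excludes. *)
Theorem Chevalley (A : set K) : is_subring A -> A q -> ~ A q^-1 ->
  exists V : valuation_ring K, (forall x, A x -> V x) /\ ~ V q^-1.
Proof.
move=> sA Aq nAq.
(* The empty set is included because the union of the empty chain is empty. *)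
pose P (W : set K) := W = set0 \/ [/\ is_subring W, A `<=` W & ~ W q^-1].
have [W [PW maxW]] : exists W, P W /\ forall W', W `<` W' -> ~ P W'.
  apply: Zorn_bigcup => F FP totF.
  have [->|/set0P[x0 [X0 FX0 X0x0]]] := eqVneq (\bigcup_(X in F) X) set0; first by left.
  have pickF X x : F X -> X x -> [/\ is_subring X, A `<=` X & ~ X q^-1].
    by move=> FX Xx; case: (FP _ FX) => // Xe; rewrite Xe in Xx.
  have pick2 x y : (\bigcup_(X in F) X) x -> (\bigcup_(X in F) X) y ->
      exists Z, [/\ F Z, Z x & Z y].
    move=> [X FX Xx] [Y FY Yy].
    by case: (totF _ _ FX FY) => sub; [exists Y|exists X]; split=> //; apply: sub.
  right; split=> [|x Ax|[X FX Xq]].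
  - split=> [|x y Ux Uy|x y Ux Uy].
    + by exists X0 => //; have [[]] := pickF _ _ FX0 X0x0.
    + have [Z [FZ Zx Zy]] := pick2 _ _ Ux Uy; exists Z => //.
      by have [[_ ZB _] _ _] := pickF _ _ FZ Zx; apply: ZB.
    + have [Z [FZ Zx Zy]] := pick2 _ _ Ux Uy; exists Z => //.
      by have [[_ _ ZM] _ _] := pickF _ _ FZ Zx; apply: ZM.
  - by exists X0 => //; have [_ sub _] := pickF _ _ FX0 X0x0; apply: sub.
  - by have [_ _] := pickF _ _ FX Xq; apply.
have [A1 _ _] := sA.
case: PW => [W0|[sW AW nWq]].
  exfalso; apply: (maxW A); last by right; split.
  by rewrite W0; split=> // /(_ 1 A1).
have [W1 WB WM] := sW.
have big x : ~ W x -> exists2 p : {poly K}, (forall i, W p`_i) & q * p.[x] = 1.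
  move=> nWx; have : adjoin W x q^-1; last first.
    by case=> p Wp e; exists p => //; rewrite -e mulfV.
  apply: contrapT => nq; apply: (maxW (adjoin W x)).
    split; first by move=> y; apply: adjoin_sub.
    by move=> /(_ x (adjoin_gen x sW)).
  by right; split=> //; [apply: adjoin_subring|move=> y /AW; apply: adjoin_sub].
have WU a : W a -> W (1 - q * a)^-1.
  move=> Wa; apply: contrapT => /big[p Wp e].
  have u0 : 1 - q * a != 0.
    apply/eqP => /eqP; rewrite subr_eq0 => /eqP e1; apply: nWq.
    by have -> : q^-1 = a by rewrite -[LHS]mulr1 e1 mulKf.
  set u := 1 - q * a in u0 e.
  have Wu : W u by apply: WB => //; apply: WM => //; apply: AW.
  pose b := \sum_(i < size p) p`_i * u ^+ (size p - i).
  have Wb : W b by apply: subring_sum => // i; apply: WM => //; apply: subring_exp.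
  have eb : q * b = u ^+ size p.
    rewrite -[RHS]mul1r -e horner_coef -mulrA; congr (_ * _); rewrite mulr_suml.
    apply: eq_bigr => i _; rewrite -mulrA; congr (_ * _).
    by rewrite exprVn mulrC expfB_cond ?(negPf u0) //; exact: ltnW (ltn_ord i).
  (* Modulo q the power u ^ n is 0, by eb, and also 1. *)
  have [b' Wb' eb'] : exists2 b', W b' & u ^+ size p = 1 - q * b'.
    elim: (size p) => [|n [b' Wb' eb']].
      by exists 0; rewrite ?mulr0 ?subr0 // -(subrr 1); apply: WB.
    exists (b' + a * (1 - q * b')); last by rewrite exprS eb' /u; ring.
    apply: subring_add => //; apply: (WM) => //; apply: (WB) => //.
    by apply: (WM) => //; apply: AW.
  apply: nWq; have -> : q^-1 = b + b'.
    by apply: (mulfI q0); rewrite mulfV // mulrDr eb eb' subrK.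
  exact: subring_add.
have Wor x : W x \/ W x^-1.
  have [|nWx] := pselect (W x); first by left.
  have [|nWx'] := pselect (W x^-1); first by right.
  have [p Wp ep] := big _ nWx; have [r Wr er] := big _ nWx'.
  by exfalso; apply: (no_relation_of_inverses sW (AW _ Aq) WU nWq (leqnn _) Wp Wr ep er).
by exists (ValuationRing W1 WB WM Wor).
Qed.
End Chevalley.

(** * Points that are generic over a subfield *)

Section Generic.
Variables (K k : fieldType) (iota : {rmorphism k -> K}).
Implicit Types (x y z w c e : K) (p a b : {poly k}) (Q f : {poly {poly k}}).

Definition ev1 z : {poly k} -> K := horner_eval z \o map_poly iota.
HB.instance Definition _ z := GRing.RMorphism.on (ev1 z).

Definition ev2 z w : {poly {poly k}} -> K := horner_eval w \o map_poly (ev1 z).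
HB.instance Definition _ z w := GRing.RMorphism.on (ev2 z w).

Lemma ev1C z (u : k) : ev1 z u%:P = iota u.
Proof. by rewrite /ev1 /= /horner_eval map_polyC hornerC. Qed.
Lemma ev1X z : ev1 z 'X = z.
Proof. by rewrite /ev1 /= /horner_eval map_polyX hornerX. Qed.
Lemma ev2C z w p : ev2 z w p%:P = ev1 z p.
Proof. by rewrite /ev2 /= /horner_eval map_polyC hornerC. Qed.
Lemma ev2X z w : ev2 z w 'X = w.
Proof. by rewrite /ev2 /= /horner_eval map_polyX hornerX. Qed.
Lemma ev2Z z w p Q : ev2 z w (p *: Q) = ev1 z p * ev2 z w Q.
Proof. by rewrite -mul_polyC rmorphM /= ev2C. Qed.

Lemma ev1M z p p' : ev1 z (p * p') = ev1 z p * ev1 z p'.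
Proof. exact: (rmorphM (ev1 z)). Qed.
Lemma ev2M z w Q Q' : ev2 z w (Q * Q') = ev2 z w Q * ev2 z w Q'.
Proof. exact: (rmorphM (ev2 z w)). Qed.
Lemma ev2B z w Q Q' : ev2 z w (Q - Q') = ev2 z w Q - ev2 z w Q'.
Proof. exact: (rmorphB (ev2 z w)). Qed.

Definition ratfield_set z : K -> Prop :=
  fun x => exists a b, ev1 z b != 0 /\ x = ev1 z a / ev1 z b.

Lemma ratfield_1 z : ratfield_set z 1.
Proof. by exists 1, 1; rewrite rmorph1 divr1 oner_neq0. Qed.

Lemma ratfield_B z x y : ratfield_set z x -> ratfield_set z y -> ratfield_set z (x - y).
Proof.
move=> [a [b [b0 ->]]] [a' [b' [b0' ->]]]; exists (a * b' - a' * b), (b * b').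
by rewrite rmorphB !rmorphM mulf_neq0 //; split=> //; field; rewrite b0 b0'.
Qed.

Lemma ratfield_div z x y : ratfield_set z x -> ratfield_set z y -> ratfield_set z (x / y).
Proof.
move=> [a [b [b0 ->]]] [a' [b' [b0' ->]]].
have [e|a0'] := eqVneq (ev1 z a') 0.
  exists 0, 1; rewrite rmorph0 rmorph1 oner_neq0 mul0r; split=> //.
  by rewrite e mul0r invr0 mulr0.
exists (a * b'), (b * a'); rewrite !rmorphM mulf_neq0 //; split=> //; field.
by rewrite b0 b0' a0'.
Qed.

Definition ratfield z : subfield K :=
  Subfield (@ratfield_1 z) (@ratfield_B z) (@ratfield_div z).

Definition alg z x := integralOver (val : sf_type (ratfield z) -> K) x.

Lemma ratfield_ev z p : ratfield z (ev1 z p).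
Proof. by exists p, 1; rewrite rmorph1 divr1 oner_neq0. Qed.

Lemma alg_ev1 z p : alg z (ev1 z p).
Proof. by have [y <-] := sf_lift (ratfield_ev z p); apply: integral_id. Qed.

Lemma alg_coef z Q :
  {in map_poly (ev1 z) Q : seq K,
      integralRange (val : sf_type (ratfield z) -> K)}.
Proof.
by apply/integral_poly => i; rewrite coef_map; apply: alg_ev1.
Qed.

Lemma alg_ev2 z w Q : alg z w -> alg z (ev2 z w Q).
Proof. by move=> aw; apply: integral_horner => //; apply: alg_coef. Qed.

Lemma alg_root z w Q : map_poly (ev1 z) Q != 0 -> ev2 z w Q = 0 -> alg z w.
Proof.
move=> Q0 e; apply: (@integral_root _ _ _ (map_poly (ev1 z) Q)) => //.
  by apply/rootP.
exact: alg_coef.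
Qed.

Definition algebraically_independent q c := forall Q, Q != 0 -> ev2 q c Q != 0.

Definition transcendental z := forall p, p != 0 -> ev1 z p != 0.

Lemma integral_not_transcendental z : integralOver iota z -> ~ transcendental z.
Proof.
move=> [p mp /rootP pz] /(_ p (monic_neq0 mp)) /eqP; apply; exact: pz.
Qed.

Lemma not_transcendental_integral z p : p != 0 -> ev1 z p = 0 -> integralOver iota z.
Proof.
move=> p0 pz; apply: (@integral_root _ _ _ (map_poly iota p)).
- by rewrite map_poly_eq0.
- by apply/rootP.
- by apply/integral_poly => i; rewrite coef_map; apply: integral_id.
Qed.

Section Valuation.
Variable V : valuation_ring K.
Let M := vr_max V.

(** The residue of [z] is transcendental over [k]; equivalently [V] contains
    the whole field [k(z)] and [z] is transcendental. *)
Definition generic z := V z /\ forall p, p != 0 -> ev1 z p != 0 /\ V (ev1 z p)^-1.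

Lemma generic_transcendental z : generic z -> transcendental z.
Proof. by move=> [_ gz] p /gz[]. Qed.

Lemma generic_const z u : generic z -> V (iota u).
Proof.
have [->|u0] := eqVneq u 0; first by rewrite rmorph0 => _; apply: vr_0.
move=> [_ gz]; have [|_] := gz (u^-1)%:P; first by rewrite polyC_eq0 invr_eq0.
by rewrite ev1C fmorphV invrK.
Qed.

Lemma generic_ev1 z p : generic z -> V (ev1 z p).
Proof.
move=> gz; elim/poly_ind: p => [|p u IH]; first by rewrite rmorph0; apply: vr_0.
rewrite rmorphD rmorphM /= ev1X ev1C; apply: vr_D; last exact: generic_const gz.
by apply: vr_M => //; case: gz.
Qed.

Lemma ratfield_V z x : generic z -> ratfield z x -> V x.
Proof.
move=> gz [a [b [b0 ->]]]; apply: vr_M; first exact: generic_ev1.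
have [_] := gz; case/(_ b) => //; apply: contraNneq b0 => ->.
by rewrite rmorph0.
Qed.

(** On [k(z)] the valuation is trivial, hence also on its algebraic extensions:
    an element that is algebraic over [k(z)] is zero or a unit. *)
Lemma alg_V z x : generic z -> alg z x -> V x.
Proof. by move=> gz; apply: vr_integral => y; apply: ratfield_V. Qed.

Lemma alg_invV z x : generic z -> alg z x -> V x^-1.
Proof. by move=> gz; apply: vr_integral_inv => y; apply: ratfield_V. Qed.

Lemma generic_cong z c p : generic c -> M (z - c) -> M (ev1 z p - ev1 c p).
Proof.
move=> gc Mzc; elim/poly_ind: p => [|p u IH].
  by rewrite !rmorph0 subrr; apply: vr_max0.
rewrite !rmorphD !rmorphM /= !ev1X !ev1C.
have -> : ev1 z p * z + iota u - (ev1 c p * c + iota u) =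
   z * (ev1 z p - ev1 c p) + ev1 c p * (z - c) by ring.
have Vc := gc.1.
apply: vr_maxD; apply: vr_maxM => //; last exact: generic_ev1.
by rewrite -[z](subrK c); apply: vr_D => //; apply: vr_max_sub.
Qed.

Lemma generic_near z c : generic c -> M (z - c) -> generic z.
Proof.
move=> gc Mzc; split=> [|p p0].
  by rewrite -[z](subrK c); apply: vr_D; [apply: vr_max_sub|case: gc].
have [_ /(_ p p0) [p0' Vp]] := gc.
by rewrite -[ev1 z p](subrK (ev1 c p)) addrC; apply: vr_unitD => //; apply: generic_cong.
Qed.

Lemma vr_max_mul x x' y y' :
  V x -> V y' -> M (x - x') -> M (y - y') -> M (x * y - x' * y').
Proof.
move=> Vx Vy' Mx My; have -> : x * y - x' * y' = x * (y - y') + y' * (x - x') by ring.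
by apply: vr_maxD; apply: vr_maxM.
Qed.

Lemma vr_max_exp x x' n : V x -> V x' -> M (x - x') -> M (x ^+ n - x' ^+ n).
Proof.
move=> Vx Vx' Mx; elim: n => [|n IH]; first by rewrite subrr; apply: vr_max0.
by rewrite !exprS; apply: vr_max_mul => //; apply: vr_X.
Qed.

End Valuation.

(** * Homogeneous forms *)

(** A form of degree [d] in [x], [y], [t] is a list of coefficients with the
    exponents of [x] and [y]; the exponent of [t] is what is missing to [d]. *)
Definition hform := seq (k * (nat * nat)).

Definition hval (H : hform) (d : nat) x y t : K :=
  \sum_(h <- H) iota h.1 * (x ^+ h.2.1 * y ^+ h.2.2 * t ^+ (d - (h.2.1 + h.2.2))).

Definition hdeg (H : hform) d := all (fun h => h.2.1 + h.2.2 <= d)%N H.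

Lemma hval_scale H d s x y t : hdeg H d ->
  hval H d (s * x) (s * y) (s * t) = s ^+ d * hval H d x y t.
Proof.
move=> /allP hd; rewrite /hval mulr_sumr; apply: eq_big_seq => h /hd.
case: h => u [n m] /= le; rewrite !exprMn.
have -> : s ^+ d = s ^+ n * s ^+ m * s ^+ (d - (n + m)) by rewrite -!exprD subnKC.
ring.
Qed.

Lemma hval_cong (V : valuation_ring K) H d x y t x' y' t' :
  (forall u, V (iota u)) -> V x -> V y -> V t -> V x' -> V y' -> V t' ->
  vr_max V (x - x') -> vr_max V (y - y') -> vr_max V (t - t') ->
  vr_max V (hval H d x y t - hval H d x' y' t').
Proof.
move=> Vk Vx Vy Vt Vx' Vy' Vt' Mx My Mt.
have VX := vr_X; have VM := vr_M.
rewrite /hval -sumrB; apply: (big_ind (vr_max V)).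
- exact: vr_max0.
- exact: vr_maxD.
move=> h _; rewrite -mulrBr; apply: vr_maxM => //.
apply: vr_max_mul; [by apply: vr_M; apply: vr_X|exact: vr_X| |exact: vr_max_exp].
by apply: vr_max_mul; [apply: vr_X|apply: vr_X|apply: vr_max_exp|apply: vr_max_exp].
Qed.

(** The form with [x = (z + w) / 2], [y = j (w - z) / 2] and [t = 1].  With
    [j = i] these are the isotropic coordinates; [j = - i] exchanges the roles
    of [z] and [w]. *)
Definition form_poly (j : k) (H : hform) : {poly {poly k}} :=
  \sum_(h <- H) h.1%:P%:P * ((2^-1)%:P%:P * ('X%:P + 'X)) ^+ h.2.1 *
    ((j / 2)%:P%:P * ('X - 'X%:P)) ^+ h.2.2.

Definition xcoord z w : K := (z + w) / 2.
Definition ycoord (j : k) z w : K := iota j * (w - z) / 2.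

Lemma ev2_form_poly j H d z w :
  ev2 z w (form_poly j H) = hval H d (xcoord z w) (ycoord j z w) 1.
Proof.
rewrite /form_poly rmorph_sum /hval; apply: eq_bigr => h _.
rewrite expr1n mulr1 -mulrA !rmorphM !rmorphXn /= !rmorphM /= rmorphB rmorphD /=.
rewrite !ev2C !ev2X !ev1X !ev1C; congr (_ * (_ ^+ _ * _ ^+ _)).
  by rewrite /xcoord mulrC fmorphV rmorph_nat.
by rewrite /ycoord fmorphV rmorph_nat mulrAC.
Qed.

Definition topcoef (R : nzRingType) (P : {poly R}) n (u : R) :=
  (size P <= n.+1)%N /\ P`_n = u.

Lemma topcoefM (R : idomainType) (P P' : {poly R}) n n' u u' :
  topcoef P n u -> topcoef P' n' u' -> topcoef (P * P') (n + n') (u * u').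
Proof.
move=> [sP <-] [sP' <-]; split.
  apply: leq_trans (size_polyMleq _ _) _.
  by move: (leq_add sP sP'); rewrite addnS addSn; case: (_ + _)%N.
rewrite coefM (bigD1 (inord n)) //= inordK ?ltnS ?leq_addr // addKn big1 ?addr0 //.
move=> i; rewrite -val_eqE /= inordK ?ltnS ?leq_addr // => ni.
case: (ltngtP i n) ni => // lt _.
  rewrite (nth_default 0 (s := P')) ?mulr0 //; apply: leq_trans sP' _.
  by rewrite ltn_subRL ltn_add2r.
by rewrite nth_default ?mul0r //; apply: leq_trans sP _.
Qed.

Lemma topcoefX (R : idomainType) (P : {poly R}) u n :
  topcoef P 1 u -> topcoef (P ^+ n) n (u ^+ n).
Proof.
move=> tP; elim: n => [|n IH]; first by split; rewrite ?size_poly1 ?coef1.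
by rewrite !exprS -add1n; apply: topcoefM.
Qed.

Lemma topcoefD (R : nzRingType) (P P' : {poly R}) n u u' :
  topcoef P n u -> topcoef P' n u' -> topcoef (P + P') n (u + u').
Proof.
move=> [sP <-] [sP' <-]; split; last by rewrite coefD.
by apply: leq_trans (size_polyD _ _) _; rewrite geq_max sP.
Qed.

Lemma topcoef_raise (R : nzRingType) (P : {poly R}) n d u : (n <= d)%N ->
  topcoef P n u -> topcoef P d (u * 0 ^+ (d - n)).
Proof.
rewrite leq_eqVlt => /predU1P[->|lt] [sP <-].
  by rewrite subnn mulr1.
split; first by apply: leq_trans sP _; rewrite ltnS ltnW.
rewrite expr0n subn_eq0 leqNgt lt mulr0 nth_default //.
exact: leq_trans sP _.
Qed.

(** The power [w ^ d] comes from the monomials without [t] only, so that its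
    coefficient is the value of the form at the isotropic point [(z, w) = (0, 1)]
    of the line at infinity. *)
Lemma form_poly_top j H d : hdeg H d ->
  exists2 u : k, topcoef (form_poly j H) d u%:P & iota u = hval H d (2^-1) (iota j / 2) 0.
Proof.
rewrite /form_poly /hval; elim: H => [|[v [n m]] H IH] /=.
  by exists 0; rewrite ?big_nil ?rmorph0 //; split; rewrite ?size_poly0 ?coef0.
move=> /andP[le /IH[u tu eu]].
exists (v * (2^-1 ^+ n * (j / 2) ^+ m * 0 ^+ (d - (n + m))) + u); last first.
  rewrite big_cons -eu rmorphD !rmorphM !rmorphXn /= !rmorphM.
  by rewrite !fmorphV rmorph_nat rmorph0.
rewrite big_cons /= rmorphD /=; apply: topcoefD => //.
have tC (c : {poly k}) : topcoef c%:P 0 c.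
  by split; rewrite ?coefC // size_polyC leq_b1.
have lin (a : {poly k}) (P : {poly {poly k}}) :
    topcoef P 1 1 -> topcoef (a%:P * P) 1 a.
  by move=> tP; rewrite -[1%N]add0n -[X in topcoef _ _ X]mulr1; apply: topcoefM.
have tX : topcoef ((2^-1)%:P%:P * ('X%:P + 'X) : {poly {poly k}}) 1 (2^-1)%:P.
  by apply: lin; split; rewrite ?(addrC 'X%:P) ?size_XaddC // coefD coefC coefX addr0.
have tY : topcoef ((j / 2)%:P%:P * ('X - 'X%:P) : {poly {poly k}}) 1 (j / 2)%:P.
  by apply: lin; split; rewrite ?size_XsubC // coefB coefC coefX subr0.
have := topcoefM (topcoefM (tC v%:P) (topcoefX n tX)) (topcoefX m tY).
move=> /(topcoef_raise le); congr topcoef.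
by rewrite !rmorphM !rmorphXn /= !rmorphM rmorph0 /= !mulrA.
Qed.

Lemma form_poly_neq0 j H d z : hdeg H d -> hval H d (2^-1) (iota j / 2) 0 != 0 ->
  form_poly j H != 0 /\ map_poly (ev1 z) (form_poly j H) != 0.
Proof.
move=> hd; have [u [_ tu] <-] := form_poly_top j hd => u0.
suff P0 : map_poly (ev1 z) (form_poly j H) != 0.
  by split=> //; apply: contraNneq P0 => ->; rewrite rmorph0.
apply: contraNneq u0 => /polyP/(_ d); rewrite coef_map /= tu ev1C coef0 => ->.
by [].
Qed.

(** * The reflection of a line close to an isotropic line *)

(** If [w] were infinite, then in homogeneous coordinates the point [(z, w)] of
    the line [z = c + e w] would be infinitely close to an isotropic point at
    infinity, and the first form would be both zero and a unit there.  So [w]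
    is finite, [z] is infinitely close to [c], and [w] is algebraic over [k(z)]
    by the first form.  As [z] is algebraic over [k(w)] by the second form, [w]
    is transcendental too. *)
Theorem isotropic_step (V : valuation_ring K) (j : k) H1 H2 d1 d2 c e z w :
  2 != 0 :> K ->
  hdeg H1 d1 -> hdeg H2 d2 ->
  hval H1 d1 (2^-1) (iota j / 2) 0 != 0 ->
  hval H2 d2 (2^-1) (iota (- j) / 2) 0 != 0 ->
  hval H1 d1 (xcoord z w) (ycoord j z w) 1 = 0 ->
  hval H2 d2 (xcoord z w) (ycoord j z w) 1 = 0 ->
  generic V c -> vr_max V e -> z = c + e * w ->
  [/\ generic V z, generic V w & alg z w].
Proof.
move=> K2 hd1 hd2 H10 H20 H1w H2w gc Me ez.
have Vk u : V (iota u) by apply: generic_const gc.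
have Vki u : V (iota u)^-1 by rewrite -fmorphV.
have V2 : V 2^-1 by rewrite -(rmorph_nat iota 2).
have Vc := gc.1.
have Vw : V w.
  (* Scale by 1 / w and compare with the isotropic point. *)
  apply: contrapT => nVw.
  have w0 : w != 0 by apply/eqP => w0; apply: nVw; rewrite w0; apply: vr_0.
  have Mv : vr_max V w^-1 by right; rewrite invrK.
  have : hval H1 d1 (w^-1 * xcoord z w) (w^-1 * ycoord j z w) (w^-1 * 1) = 0.
    by rewrite hval_scale // H1w mulr0.
  have Mcv : vr_max V (w^-1 * z).
    have -> : w^-1 * z = c * w^-1 + e by rewrite ez; field.
    by apply: vr_maxD => //; apply: vr_maxM.
  have ex : w^-1 * xcoord z w - 2^-1 = 2^-1 * (w^-1 * z).
    by rewrite /xcoord; field; rewrite w0 K2.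
  have ey : w^-1 * ycoord j z w - iota j / 2 = - (iota j * 2^-1) * (w^-1 * z).
    by rewrite /ycoord; field; rewrite w0 K2.
  have Mx : vr_max V (w^-1 * xcoord z w - 2^-1) by rewrite ex; apply: vr_maxM.
  have My : vr_max V (w^-1 * ycoord j z w - iota j / 2).
    by rewrite ey; apply: vr_maxM => //; apply: vr_N; apply: vr_M.
  have Mt : vr_max V (w^-1 * 1 - 0) by rewrite mulr1 subr0.
  have subV x x' : V x' -> vr_max V (x - x') -> V x.
    by move=> Vx' Mxx; rewrite -[x](subrK x'); apply: vr_D => //; apply: vr_max_sub.
  have Vj2 : V (iota j / 2) by apply: vr_M.
  have := @hval_cong V H1 d1 _ _ _ _ _ _ Vk (subV _ _ V2 Mx) (subV _ _ Vj2 My)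
     (subV _ _ (vr_0 V) Mt) V2 Vj2 (vr_0 V) Mx My Mt.
  move=> Mh h0; rewrite h0 sub0r in Mh; have := vr_maxN Mh; rewrite opprK.
  have [u _ eu] := form_poly_top j hd1; rewrite -eu in H10 *.
  by move=> /vr_max_inv/(_ (Vki u))/eqP; rewrite (negPf H10).
have Mz : vr_max V (z - c) by rewrite ez addrC addKr mulrC; apply: vr_maxM.
have gz := generic_near gc Mz.
have aw : alg z w.
  have [_ f0] := form_poly_neq0 z hd1 H10.
  by apply: alg_root f0 _; rewrite (ev2_form_poly _ _ d1).
split=> //; split=> // p p0.
have aw2 : alg z (ev1 w p).
  have -> : ev1 w p = ev2 z w (map_poly polyC p).
    rewrite /ev2 /= /horner_eval -map_poly_comp; congr (horner _ w).
    by apply: eq_map_poly => u /=; rewrite ev1C.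
  exact: alg_ev2.
split; last exact: alg_invV gz aw2.
apply/eqP => pw; apply: (@integral_not_transcendental z);
  last exact: generic_transcendental gz.
have iw := not_transcendental_integral p0 pw.
have [_ f0] := form_poly_neq0 w hd2 H20.
apply: (integral_root f0).
  apply/rootP; change (ev2 w z (form_poly (- j) H2) = 0).
  rewrite (ev2_form_poly _ _ d2) -H2w /xcoord /ycoord; congr (hval _ _ _ _ _).
    by rewrite addrC.
  by rewrite rmorphN; congr (_ / 2); ring.
apply/integral_poly => i; rewrite coef_map /ev1 /= /horner_eval.
apply: integral_horner => //; apply/integral_poly => l; rewrite coef_map.
exact: integral_id.
Qed.

Import Pdiv.Idomain.

(** For [Q] of minimal degree in [w] among the nonzero polynomials that vanish at
    the point, the derivative of [Q] cannot vanish there.  Pseudo-division shows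
    that [f] is, up to factors that are nonzero at the point, a power of [Q];
    this is how the zeros of [f] near the point become zeros of [Q]. *)
Theorem min_relation z w f : transcendental z -> [pchar k] =i pred0 ->
  f != 0 -> ev2 z w f = 0 ->
  exists Q (E : {poly k}) r H, [/\ ev2 z w Q = 0, ev2 z w Q^`() != 0, ev2 z w H != 0
    & E *: f = Q ^+ r * H].
Proof.
move=> tz ch0 f0 fw.
pose P n := `[< exists Q, [/\ Q != 0, ev2 z w Q = 0 & size Q = n] >].
have exP : exists n, P n by exists (size f); apply/asboolP; exists f.
case: (ex_minnP exP) => n /asboolP[Q [Q0 Qw sQ]] minn.
have minQ Q' : ev2 z w Q' = 0 -> (size Q' < size Q)%N -> Q' = 0.
  move=> Qw' lt; apply/eqP/negPn/negP => Q0'; move: lt; rewrite ltnNge sQ minn //.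
  by apply/asboolP; exists Q'.
have lcQ : ev1 z (lead_coef Q) != 0 by apply: tz; rewrite lead_coef_eq0.
have dQ : ev2 z w Q^`() != 0.
  apply/eqP => /minQ dQ0.
  have {}dQ0 : Q^`() = 0 by apply: dQ0; apply: lt_size_deriv.
  have sQ1 : (size Q <= 1)%N.
    rewrite leqNgt; apply/negP => lt.
    have : Q^`()`_(size Q).-2 = 0 by rewrite dQ0 coef0.
    rewrite coef_deriv prednK; last by rewrite -ltnS prednK // ltnW.
    rewrite -mulr_natr => /eqP; rewrite mulf_eq0 -lead_coefE lead_coef_eq0 (negPf Q0) /=.
    rewrite -polyC_natr polyC_eq0 => /eqP.
    have [m em] : exists m, (size Q).-1 = m.+1.
      by exists (size Q).-2; rewrite prednK // -ltnS prednK // ltnW.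
    rewrite em; move/eqP; rewrite (pcharf0P k).1 //.
  move: lcQ Qw; rewrite (size1_polyC sQ1) ev2C lead_coefC => /eqP h /h.
  by [].
exists Q.
suff main n' (g : {poly {poly k}}) : g != 0 -> (size g <= n')%N ->
    exists (E : {poly k}) r H,
      [/\ ev1 z E != 0, ev2 z w H != 0 & E *: g = Q ^+ r * H].
  by have [E [r [H [_ H0 eE]]]] := main _ f f0 (leqnn _); exists E, r, H.
elim: n' g => [|n' IH] g g0.
  by rewrite leqn0 size_poly_eq0 (negPf g0).
move=> sg; have [gw|gw] := eqVneq (ev2 z w g) 0; last first.
  by exists 1, 0%N, g; rewrite scale1r mul1r rmorph1 oner_neq0.
have eg := divp_eq g Q.
have m0 : g %% Q = 0.
  apply: minQ; last by rewrite ltn_modp.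
  have := congr1 (ev2 z w) eg.
  by rewrite ev2Z gw mulr0 rmorphD rmorphM /= Qw mulr0 add0r => <-.
rewrite m0 addr0 in eg.
have q0 : g %/ Q != 0.
  apply: contraNneq g0 => q0; move/eqP: eg; rewrite q0 mul0r -mul_polyC.
  by rewrite mulf_eq0 polyC_eq0 expf_eq0 lead_coef_eq0 (negPf Q0) andbF.
have sQ1 : (1 < size Q)%N.
  rewrite ltnNge; apply/negP => sQ1.
  move: lcQ Qw; rewrite (size1_polyC sQ1) ev2C lead_coefC => /eqP h /h.
  by [].
have slt : (size (g %/ Q)%R <= n')%N.
  rewrite size_divp // leq_subLR; apply: leq_trans sg _.
  by rewrite -add1n leq_add2r -ltnS prednK // ltnW.
have [E [r [H [E0 H0 eE]]]] := IH _ q0 slt.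
exists (E * lead_coef Q ^+ scalp g Q), r.+1, H; split=> //.
  by rewrite rmorphM rmorphXn mulf_neq0 // expf_neq0.
by rewrite -scalerA eg scalerAl eE exprS mulrC mulrA.
Qed.

End Generic.

(** * Real and complex polynomial functions *)

Section Hadamard.
Variables (K k : fieldType) (iota : {rmorphism k -> K}).

Definition ev2K z w (P : {poly {poly K}}) : K := P.[w%:P].[z].

Lemma ev2_ev2K z w (Q : {poly {poly k}}) :
  ev2 iota z w Q = ev2K z w (map_poly (map_poly iota) Q).
Proof.
have := horner_map (horner_eval z) (map_poly (map_poly iota) Q) w%:P.
by rewrite -map_poly_comp /ev2K /= /horner_eval hornerC => <-.
Qed.

(** The lemma of Hadamard: the increments are exact and not only of first order,
    which makes differentiation at the point purely algebraic. *)
Lemma hadamard (P : {poly {poly K}}) z w : exists A B : {poly {poly K}},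
  [/\ ev2K z w A = ev2K z w (map_poly deriv P), ev2K z w B = ev2K z w P^`() &
      forall z' w', ev2K z' w' P - ev2K z w P =
        (z' - z) * ev2K z' w' A + (w' - w) * ev2K z' w' B].
Proof.
have : root (P - P.[w%:P]%:P) w%:P by rewrite rootE hornerD hornerN hornerC subrr.
move=> /factor_theorem[B eB].
have : root (P.[w%:P] - P.[w%:P].[z]%:P) z by rewrite rootE hornerD hornerN hornerC subrr.
move=> /factor_theorem[A eA].
exists A%:P, B; split.
- have := congr1 (fun p : {poly K} => p^`().[z]) eA.
  rewrite derivB derivC subr0 derivM derivXsubC mulr1 !hornerE subrr mulr0 add0r => e.
  rewrite /ev2K hornerC -e; congr (horner _ z).
  elim/poly_ind: P {eB eA e} => [|P p IH]; first by rewrite map_poly0 !horner0 deriv0.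
  have -> : map_poly deriv (P * 'X + p%:P) = map_poly deriv P * 'X + (p^`())%:P.
    apply/polyP => i; rewrite coef_map /= !coefD !coefMX !coefC.
    by case: i => [|i] /=; rewrite ?add0r ?addr0 ?coef_map.
  rewrite !hornerE.
  by rewrite derivD derivM derivC mulr0 addr0 IH.
- have := congr1 (fun p : {poly {poly K}} => p^`().[w%:P].[z]) eB.
  rewrite derivB derivC subr0 derivM derivXsubC mulr1 !hornerE subrr mulr0 add0r => e.
  by rewrite /ev2K e.
move=> z' w'.
have /eqP := congr1 (fun p : {poly {poly K}} => p.[w'%:P].[z']) eB.
rewrite !hornerE subr_eq => /eqP.
have /eqP := congr1 (fun p : {poly K} => p.[z']) eA.
rewrite !hornerE subr_eq => /eqP e1 e2.
rewrite /ev2K e2 e1 !hornerE /=; ring.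
Qed.
End Hadamard.

(** The complex functions with real and imaginary part in a class [C] that is
    closed under sums and products are stable under polynomials.  The class is
    that of the functions continuous at a point or that of the measurable
    functions. *)
Section FunClass.
Variables (R : realType) (T : Type) (C : set (T -> R)).
Hypotheses (C_cst : forall a, C (fun=> a))
  (C_D : forall f g, C f -> C g -> C (fun t => f t + g t))
  (C_M : forall f g, C f -> C g -> C (fun t => f t * g t)).

Definition cclass (f : T -> R[i]) :=
  C (fun t => complex.Re (f t)) /\ C (fun t => complex.Im (f t)).

Lemma cclass_cst a : cclass (fun=> a).
Proof. by split; apply: C_cst. Qed.

Lemma cclass_D f g : cclass f -> cclass g -> cclass (fun t => f t + g t).
Proof.
move=> [f1 f2] [g1 g2]; split.
  by under eq_fun do rewrite raddfD /=; apply: C_D.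
by under eq_fun do rewrite raddfD /=; apply: C_D.
Qed.

Lemma cclass_M f g : cclass f -> cclass g -> cclass (fun t => f t * g t).
Proof.
move=> [f1 f2] [g1 g2]; split.
  rewrite (_ : (fun t => _) = fun t => complex.Re (f t) * complex.Re (g t) +
      (-1 * complex.Im (f t)) * complex.Im (g t)).
    by apply: C_D; [exact: C_M|apply: C_M => //; exact: C_M].
  by apply/funext => t; case: (f t) (g t) => a b [c d] /=; rewrite mulN1r mulNr.
rewrite (_ : (fun t => _) = fun t => complex.Re (f t) * complex.Im (g t) +
    complex.Im (f t) * complex.Re (g t)).
  by apply: C_D; exact: C_M.
by apply/funext => t; case: (f t) (g t) => a b [c d].
Qed.

Lemma cclass_ev2 (k : fieldType) (iota : {rmorphism k -> R[i]}) f g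
    (Q : {poly {poly k}}) :
  cclass f -> cclass g -> cclass (fun t => ev2 iota (f t) (g t) Q).
Proof.
move=> cf cg; elim/poly_ind: Q => [|Q p IH].
  by under eq_fun do rewrite rmorph0; apply: cclass_cst.
under eq_fun do rewrite rmorphD rmorphM /= ev2X ev2C.
apply: cclass_D; first exact: cclass_M.
elim/poly_ind: p {IH} => [|p u IH].
  by under eq_fun do rewrite rmorph0; apply: cclass_cst.
under eq_fun do rewrite rmorphD rmorphM /= ev1X ev1C.
by apply: cclass_D; [exact: cclass_M|exact: cclass_cst].
Qed.

End FunClass.

(** * Tangents of arcs of algebraic curves *)

Section Tangent.
Variables (R : realType) (k : fieldType) (iota : {rmorphism k -> R[i]}).
Implicit Types (p a tau : R * R) (G : set (R * R)).

(** The isotropic coordinates of a real point. *)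
Definition zc p : R[i] := Complex p.1 p.2.
Definition wc p : R[i] := Complex p.1 (- p.2).

Definition sqn (x : R[i]) : R := complex.Re x ^+ 2 + complex.Im x ^+ 2.

Lemma sqn_ge0 x : 0 <= sqn x.
Proof. by rewrite addr_ge0 ?sqr_ge0. Qed.

Lemma sqn_eq0 x : sqn x = 0 -> x = 0.
Proof.
case: x => a b /eqP; rewrite /sqn /= paddr_eq0 ?sqr_ge0 // !sqrf_eq0.
by move=> /andP[/eqP-> /eqP->].
Qed.

Lemma sqnM x y : sqn (x * y) = sqn x * sqn y.
Proof. by case: x y => a b [c d]; rewrite /sqn /=; ring. Qed.

Definition cont_at a : set (R * R -> R) := [set f | {for a, continuous f}].

Lemma cont_cst a (c : R) : cont_at a (fun=> c).
Proof. exact: cvg_cst. Qed.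
Lemma cont_D a f g : cont_at a f -> cont_at a g -> cont_at a (fun p => f p + g p).
Proof. by move=> cf cg; apply: cvgD. Qed.
Lemma cont_M a f g : cont_at a f -> cont_at a g -> cont_at a (fun p => f p * g p).
Proof. by move=> cf cg; apply: cvgM. Qed.

Lemma cont_zc a : cclass (cont_at a) zc.
Proof. by split; [exact: cvg_fst|exact: cvg_snd]. Qed.
Lemma cont_wc a : cclass (cont_at a) wc.
Proof.
split; first exact: cvg_fst.
by apply: cvgN; exact: cvg_snd.
Qed.

Lemma cont_ev2 a (k' : fieldType) (io : {rmorphism k' -> R[i]}) Q :
  cclass (cont_at a) (fun p => ev2 io (zc p) (wc p) Q).
Proof.
exact: (cclass_ev2 (@cont_cst a) (@cont_D a) (@cont_M a) io Q (cont_zc a) (cont_wc a)).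
Qed.

Lemma cont_sqn a f : cclass (cont_at a) f -> cont_at a (fun p => sqn (f p)).
Proof. by move=> [c1 c2]; apply: cont_D; apply: cont_M. Qed.

Lemma limit_point_proper G a : limit_point G a -> ProperFilter (within G a^').
Proof.
move=> la; apply: Build_ProperFilter_ex => P /la[y [ya Gy Py]].
by exists y; apply: Py.
Qed.

Lemma cvg_limit_point G a f : cont_at a f -> f p @[p --> within G a^'] --> f a.
Proof.
by apply: cvg_trans => P; rewrite /nbhs /= => h; apply: filterS h => y.
Qed.

Lemma near_limit_neq G a : \forall p \near within G a^', p != a.
Proof. by apply: cvg_within; apply: withinT. Qed.

Lemma zero_at_limit_point G a Q : limit_point G a ->
  (\forall p \near within G a^', ev2 iota (zc p) (wc p) Q = 0) ->
  ev2 iota (zc a) (wc a) Q = 0.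
Proof.
move=> la hQ; have PF := limit_point_proper la.
apply: sqn_eq0; apply/eqP; rewrite eq_le sqn_ge0 andbT.
have c1 := cvg_limit_point G (cont_sqn (cont_ev2 a iota Q)).
have c0 : (fun=> 0) @ within G a^' --> (0 : R) by exact: cvg_cst.
apply: (ler_cvg_to c1 c0).
near=> p; have -> : ev2 iota (zc p) (wc p) Q = 0 by near: p.
by rewrite /sqn /= expr0n addr0.
Unshelve. all: by end_near. Qed.

Lemma near_neq0 G a Q : ev2 iota (zc a) (wc a) Q != 0 ->
  \forall p \near within G a^', ev2 iota (zc p) (wc p) Q != 0.
Proof.
move=> Q0.
have c1 := cvg_limit_point G (cont_sqn (cont_ev2 a iota Q)).
have s0 : 0 < sqn (ev2 iota (zc a) (wc a) Q).
  by rewrite lt_neqAle sqn_ge0 andbT; apply: contra_neq Q0 => /esym/sqn_eq0.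
have h : \forall p \near within G a^', 0 < sqn (ev2 iota (zc p) (wc p) Q).
  exact: cvgr_gt c1 _ s0.
apply: filterS h => p; apply: contraTneq => ->.
by rewrite /sqn /= expr0n /= addr0 ltxx.
Qed.

(** The defect of orthogonality at [a] is the limit of that of the Hadamard
    coefficients at the points [p] of [G], and the latter is bounded by the
    distance from [p] to the tangent divided by [|p - a|]. *)
Theorem tangent_gradient G a tau Q : limit_point G a ->
  (fun p => cross (p - a) tau / `|p - a|) @ within G a^' --> (0 : R) ->
  (\forall p \near within G a^', ev2 iota (zc p) (wc p) Q = 0) ->
  ev2 iota (zc a) (wc a) (map_poly deriv Q) * zc tau +
  ev2 iota (zc a) (wc a) Q^`() * wc tau = 0.
Proof.
move=> la tgt hQ; have PF := limit_point_proper la.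
have Qa := zero_at_limit_point la hQ.
have [A [B [eA eB had]]] := hadamard (map_poly (map_poly iota) Q) (zc a) (wc a).
pose D p := ev2K (zc p) (wc p) A * zc tau + ev2K (zc p) (wc p) B * wc tau.
have -> : ev2 iota (zc a) (wc a) (map_poly deriv Q) * zc tau +
  ev2 iota (zc a) (wc a) Q^`() * wc tau = D a.
  rewrite /D eA eB !ev2_ev2K; congr (_ * _ + _ * _); last by rewrite deriv_map.
  rewrite -!map_poly_comp; congr (ev2K _ _ _); apply: eq_map_poly => q /=.
  by rewrite deriv_map.
have cK P : cclass (cont_at a) (fun p => ev2K (zc p) (wc p) P).
  have -> : (fun p => ev2K (zc p) (wc p) P) = fun p => ev2 idfun (zc p) (wc p) P.
    apply/funext => p; rewrite ev2_ev2K; congr (ev2K _ _ _).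
    by rewrite (eq_map_poly (g := idfun)) ?map_poly_id // => q /=; rewrite map_poly_id.
  exact: cont_ev2.
have cD : cont_at a (fun p => sqn (D p)).
  apply: cont_sqn; apply: (cclass_D (@cont_D a)).
    apply: (cclass_M (@cont_cst a) (@cont_D a) (@cont_M a)) => //.
    exact: (cclass_cst (@cont_cst a)).
  apply: (cclass_M (@cont_cst a) (@cont_D a) (@cont_M a)) => //.
  exact: (cclass_cst (@cont_cst a)).
have cB := cont_sqn (cK B).
apply: sqn_eq0; apply/eqP; rewrite eq_le sqn_ge0 andbT.
have lim0 : (fun p => 4 * (cross (p - a) tau / `|p - a|) ^+ 2 *
   sqn (ev2K (zc p) (wc p) B)) @ within G a^' -->
   (4 * (0 : R) ^+ 2 * sqn (ev2K (zc a) (wc a) B)).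
  apply: cvgM; last exact: (cvg_limit_point G cB).
  by apply: cvgM; [exact: cvg_cst|apply: cvgM].
rewrite expr0n mulr0 mul0r in lim0.
apply: (ler_cvg_to (cvg_limit_point G cD) lim0).
near=> p.
have pa : p != a by near: p; exact: near_limit_neq.
have Qp : ev2 iota (zc p) (wc p) Q = 0 by near: p.
have /esym h := had (zc p) (wc p).
rewrite -!ev2_ev2K Qp Qa subrr in h.
set cr := cross (p - a) tau.
(* Up to the factor -2 i the determinant of two real vectors in isotropic
   coordinates is their cross product. *)
have eD : (zc p - zc a) * D p = Complex 0 (- 2 * cr) * ev2K (zc p) (wc p) B.
  have -> : Complex 0 (- 2 * cr) = (zc p - zc a) * wc tau - (wc p - wc a) * zc tau.
    rewrite /cr /cross /zc /wc /=; apply/eqP; rewrite eq_complex /=.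
    by apply/andP; split; apply/eqP; ring.
  rewrite /D; transitivity (zc tau * ((zc p - zc a) * ev2K (zc p) (wc p) A +
      (wc p - wc a) * ev2K (zc p) (wc p) B) +
      ((zc p - zc a) * wc tau - (wc p - wc a) * zc tau) * ev2K (zc p) (wc p) B).
    by ring.
  by rewrite h mulr0 add0r.
have := congr1 sqn eD; rewrite !sqnM => {}eD.
have s1 : sqn (Complex 0 (- 2 * cr)) = 4 * cr ^+ 2 by rewrite /sqn /=; ring.
rewrite s1 in eD.
have n0 : 0 < `|p - a| by rewrite normr_gt0 subr_eq0.
(* The norm of the plane is the maximum norm, below the Euclidean one. *)
have le_n : `|p - a| ^+ 2 <= sqn (zc p - zc a).
  rewrite /sqn /= prod_normE /=; case: (leP `|(p - a).1| `|(p - a).2|) => _.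
    by rewrite real_normK ?num_real // lerDr sqr_ge0.
  by rewrite real_normK ?num_real // lerDl sqr_ge0.
rewrite expr_div_n mulrA -mulrAC ler_pdivlMr ?exprn_gt0 // -eD mulrC.
by rewrite ler_wpM2r ?sqn_ge0.
Unshelve. all: by end_near. Qed.

End Tangent.

(** * Countable subfields and generic lines *)

Section Countable.

Lemma countable_preimage T U (f : T -> U) (A : set T) (B : set U) :
  {in A &, injective f} -> (forall x, A x -> B (f x)) -> countable B -> countable A.
Proof.
move=> fi AB /countable_injP[g gi]; apply/countable_injP; exists (g \o f).
move=> x y; rewrite !inE => Ax Ay /= e; apply: fi; rewrite ?inE //.
by apply: gi; rewrite ?inE //; apply: AB.
Qed.

Lemma countable_setU T (A B : set T) : countable A -> countable B -> countable (A `|` B).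
Proof.
move=> cA cB; rewrite -bigcup2E; apply: bigcup_countable => // i _.
by case: i => [|[|i]] /=.
Qed.

Lemma countable_image T U (f : T -> U) (A : set T) : countable A -> countable (f @` A).
Proof. by apply: sub_countable; apply: card_image_le. Qed.

Section Subfield.
Variables (K : fieldType) (S : set K).

Fixpoint closure_step n : set K :=
  if n is n'.+1 then
    closure_step n' `|`
      ((fun u => u.1 - u.2) @` (closure_step n' `*` closure_step n') `|`
       (fun u => u.1 / u.2) @` (closure_step n' `*` closure_step n'))
  else [set 1] `|` S.

Lemma closure_step_mono m n x : (m <= n)%N -> closure_step m x -> closure_step n x.
Proof.
by move=> /subnK <- h; elim: (n - m)%N => //= l IH; left.
Qed.

Let gen : set K := \bigcup_n closure_step n.

Let gen_op (op : K -> K -> K) : (forall n x y, closure_step n x -> closure_step n y ->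
    closure_step n.+1 (op x y)) -> forall x y, gen x -> gen y -> gen (op x y).
Proof.
move=> h x y [n _ nx] [m _ my]; exists (maxn n m).+1 => //; apply: h.
  by apply: closure_step_mono nx; apply: leq_maxl.
by apply: closure_step_mono my; apply: leq_maxr.
Qed.

Let gen_1 : gen 1. Proof. by exists 0%N => //=; left. Qed.
Let gen_B x y : gen x -> gen y -> gen (x - y).
Proof.
by apply: (gen_op (op := fun a b => a - b)) => n a b ha hb /=; right; left; exists (a, b).
Qed.
Let gen_div x y : gen x -> gen y -> gen (x / y).
Proof.
by apply: (gen_op (op := fun a b => a / b)) => n a b ha hb /=; right; right; exists (a, b).
Qed.

Theorem countable_subfield : countable S ->
  exists k : subfield K, countable [set: sf_type k] /\ forall x, S x -> k x.
Proof.
move=> cS; exists (Subfield gen_1 gen_B gen_div); split; last first.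
  by move=> x Sx; exists 0%N => //=; right.
apply: (@countable_preimage _ _ (val : sf_type _ -> K) _ gen).
- by move=> x y _ _; apply: val_inj.
- by move=> x _; apply: (sf_setP x).
apply: bigcup_countable => // n _; elim: n => [|n IH] /=.
  by apply: countable_setU => //; apply: countable1.
by do 2?apply: countable_setU => //; apply: countable_image; apply: countableX.
Qed.
End Subfield.

Lemma countable_poly2 (k : fieldType) : countable [set: k] ->
  exists e : {poly {poly k}} -> nat, injective e.
Proof.
move=> /countable_injP[g gi].
have {}gi : injective g by move=> x y; apply: gi; rewrite inE.
exists (fun Q => choice.pickle (map (fun p : {poly k} => map g p) Q)) => Q Q'.
move=> /(pcan_inj choice.pickleK) e; apply: val_inj => /=.
apply: (inj_map _ e) => p p' /= e'; apply: val_inj => /=.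
exact: (inj_map gi e').
Qed.

End Countable.

Section GenericLine.
Variables (R : realType).

Lemma roots_finite (p : {poly R[i]}) : p != 0 -> countable [set x | p.[x] = 0].
Proof.
move=> p0; have [rs e] := closed_field_poly_normal p.
apply: finite_set_countable; apply: sub_finite_set (finite_seq rs) => x /= /eqP px.
have : root p x by rewrite rootE.
by rewrite e rootZ ?lead_coef_eq0 // root_prod_XsubC.
Qed.

(** The line [l] has the equation [z - q ^ 2 w = c] with these [q] and [c]. *)
Definition line_q (l : R * R) : R[i] := zc (line_dir l).
Definition line_c (l : R * R) : R[i] := Complex 0 (2 * l.2) * line_q l.

Lemma line_q_neq0 l : line_q l != 0.
Proof.
apply/eqP => h; have : sqn (line_q l) = 0 by rewrite h /sqn /= expr0n addr0.
by rewrite /sqn /= cos2Dsin2 => /eqP; rewrite oner_eq0.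
Qed.

Lemma cos_sin_inj (x y : R) : 0 <= x < 2 * pi -> 0 <= y < 2 * pi ->
  cos x = cos y -> sin x = sin y -> x = y.
Proof.
have pi0 := pi_gt0 R.
wlog lexy : x y / x <= y.
  move=> hw hx hy hc hs; case: (leP x y) => [le|/ltW le]; first exact: hw.
  by symmetry; apply: hw.
move=> /andP[x0 x2] /andP[y0 y2] hc hs.
case: (leP y pi) => [yp|yp].
  by apply: cos_inj; rewrite // in_itv /=; apply/andP; split=> //; exact: le_trans lexy yp.
case: (ltP pi x) => [xp|xp].
  have : x - pi = y - pi.
    apply: cos_inj; rewrite ?in_itv /=.
    - by apply/andP; split; lra.
    - by apply/andP; split; lra.
    - by apply: oppr_inj; rewrite -!cosDpi !subrK.
  by move/addIr.
have s0 : 0 <= sin x by apply: sin_ge0_pi; rewrite x0 xp.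
have : 0 < sin (y - pi) by apply: sin_gt0_pi; apply/andP; split; lra.
by rewrite -oppr_lt0 -sinDpi subrK -hs ltNge s0.
Qed.

Local Notation T := (measurableTypeR R * measurableTypeR R)%type.

Definition measurable_class : set (T -> R) := [set f | measurable_fun setT f].

Lemma meas_cst (c : R) : measurable_class (fun=> c).
Proof. exact: measurable_cst. Qed.
Lemma meas_D f g : measurable_class f -> measurable_class g ->
  measurable_class (fun p => f p + g p).
Proof. by move=> cf cg; apply: measurable_funD. Qed.
Lemma meas_M f g : measurable_class f -> measurable_class g ->
  measurable_class (fun p => f p * g p).
Proof. by move=> cf cg; apply: measurable_funM. Qed.

Lemma meas_q : cclass measurable_class line_q.
Proof.
split.
  apply: (measurableT_comp (f := cos)); last exact: measurable_fst.
  by apply: continuous_measurable_fun; exact: continuous_cos.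
apply: (measurableT_comp (f := sin)); last exact: measurable_fst.
by apply: continuous_measurable_fun; exact: continuous_sin.
Qed.

Lemma meas_c : cclass measurable_class line_c.
Proof.
apply: (cclass_M meas_cst meas_D meas_M); last exact: meas_q.
split; first exact: meas_cst.
by apply: meas_M; [exact: meas_cst|exact: measurable_snd].
Qed.

Variables (k : fieldType) (iota : {rmorphism k -> R[i]}).

Definition dependent_lines (Q : {poly {poly k}}) : set T :=
  [set l | oriented_lines l /\ ev2 iota (line_q l) (line_c l) Q = 0].

Lemma dependent_lines_measurable Q : measurable (dependent_lines Q).
Proof.
have m : measurable_fun setT (fun l : T => sqn (ev2 iota (line_q l) (line_c l) Q)).
  have [m1 m2] := cclass_ev2 meas_cst meas_D meas_M iota Q meas_q meas_c.
  by apply: measurable_funD; apply: measurable_funM.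
have -> : dependent_lines Q = (`[0, 2 * pi[%classic `*` setT) `&`
   ((fun l : T => sqn (ev2 iota (line_q l) (line_c l) Q)) @^-1` [set 0]).
  apply/seteqP; split=> [l [[l0 l1] e]|l [[/= + _] e]].
    split; first by split=> //=; rewrite in_itv /= l0.
    by rewrite /= e /sqn /= expr0n addr0.
  rewrite in_itv /= => /andP[l0 l1]; split=> //.
  exact: sqn_eq0.
apply: measurableI; first by apply: measurableX.
by rewrite -[X in measurable X]setTI; apply: m.
Qed.

(** For all but countably many angles [t] the polynomial does not degenerate at
    [q], and then only countably many distances [r] are roots; so almost all
    sections are null. *)
Lemma dependent_lines_null Q : Q != 0 -> line_measure (dependent_lines Q) = 0%E.
Proof.
move=> Q0; rewrite /line_measure /product_measure1 /=.
pose T0 : set R := [set t | 0 <= t < 2 * pi /\ map_poly (ev1 iota (line_q (t, 0))) Q = 0].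
have cT0 : countable T0.
  apply: (@countable_preimage _ _ (fun t => line_q (t, 0)) _
     [set x | (map_poly iota (lead_coef Q)).[x] = 0]).
  - move=> x y; rewrite !inE => -[hx _] [hy _] /= e.
    have := congr1 (@complex.Re R) e; have := congr1 (@complex.Im R) e => /= es ec.
    exact: cos_sin_inj.
  - move=> x [_ /polyP/(_ (size Q).-1)]; rewrite coef_map coef0 -lead_coefE.
    by [].
  by apply: roots_finite; rewrite map_poly_eq0 lead_coef_eq0.
have mb := dependent_lines_measurable Q.
have sec0 t : ~ T0 t -> lebesgue_measure (xsection (dependent_lines Q) t) = 0%E.
  move=> nT; apply: countable_lebesgue_measure0.
  have [ht|ht] := pselect (0 <= t < 2 * pi); last first.
    rewrite (_ : xsection _ _ = set0) //; apply/seteqP; split=> // r.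
    rewrite /xsection /= inE => -[[/= h1 h2] _]; apply: ht.
    by rewrite h1 h2.
  have P0 : map_poly (ev1 iota (line_q (t, 0))) Q != 0 by apply/eqP => e; apply: nT.
  apply: (@countable_preimage _ _ (fun r => line_c (t, r)) _ _ _ _ (roots_finite P0)).
    move=> r r' _ _ /(mulIf (line_q_neq0 _)) /(congr1 (@complex.Im R)) /= /mulfI; apply.
    by rewrite pnatr_eq0.
  by move=> r; rewrite /xsection /= inE => -[_].
have -> : (\int[lebesgue_measure]_x
    (lebesgue_measure \o xsection (dependent_lines Q)) x)%E =
   (\int[@lebesgue_measure R]_x (cst 0 x))%E.
  apply: ge0_ae_eq_integral => //.
    exact: measurable_fun_xsection.
  exists T0; split; [exact: countable_measurable|exact: countable_lebesgue_measure0|].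
  move=> t /= h; apply: contrapT => nT; apply: h => _; exact: sec0.
by rewrite integral0.
Qed.

(** There are only countably many polynomials over a countable field. *)
Theorem generic_line : countable [set: k] ->
  (@line_measure R).-negligible
    [set l : T | oriented_lines l /\
       ~ algebraically_independent iota (line_q l) (line_c l)].
Proof.
move=> /countable_poly2[e ei].
pose F n : set T := [set l | exists Q, [/\ Q != 0, e Q = n & dependent_lines Q l]].
apply: (@negligibleS _ _ _ _ (\bigcup_n F n)).
  move=> l [ol /existsNP[Q /not_implyP[Q0 /negP/negPn/eqP Ql]]].
  by exists (e Q) => //; exists Q.
apply: negligible_bigcup => n.
have [[Q [Q0 eQ]]|nQ] := pselect (exists Q, Q != 0 /\ e Q = n).
  exists (dependent_lines Q).
  split; [exact: dependent_lines_measurable|exact: dependent_lines_null|].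
  by move=> l [Q' [_ eQ' bQ']]; rewrite (ei Q Q') // eQ.
exists (dependent_lines 1); split; first exact: dependent_lines_measurable.
  exact: dependent_lines_null (oner_neq0 _).
by move=> l [Q [Q0 eQ _]]; case: nQ; exists Q.
Qed.

End GenericLine.

(** * The invariant of the orbit *)

Section Place.
Variables (K k : fieldType) (iota : {rmorphism k -> K}).

Lemma ev2_swapXY z w (Q : {poly {poly k}}) :
  ev2 iota z w (swapXY Q) = ev2 iota w z Q.
Proof. by rewrite !ev2_ev2K /ev2K -swapXY_map horner2_swapXY. Qed.

(** As [q] is transcendental over [k(c)], the ring [k(c)[q]] does not contain
    [1/q], and the theorem of Chevalley applies to it. *)
Theorem generic_place (q c : K) :
  algebraically_independent iota q c ->
  exists V : valuation_ring K, [/\ q != 0, vr_max V q & generic iota V c].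
Proof.
move=> ind.
have indc D : D != 0 -> ev1 iota c D != 0.
  move=> D0; have := ind (swapXY D%:P); rewrite swapXY_eq0 polyC_eq0 => /(_ D0).
  by rewrite ev2_swapXY ev2C.
have q0 : q != 0.
  have := ind 'X%:P; rewrite polyC_eq0 polyX_eq0 ev2C ev1X; exact.
pose A : set K := [set x | exists (P : {poly {poly k}}) D,
  D != 0 /\ x = ev2 iota c q P / ev1 iota c D].
have sA : is_subring A.
  split.
  - by exists 1, 1; rewrite oner_neq0 !rmorph1 divr1.
  - move=> _ _ [P [D [D0 ->]]] [P' [D' [D'0 ->]]].
    exists (P * D'%:P - P' * D%:P), (D * D'); rewrite mulf_neq0 //; split=> //.
    have -> : ev2 iota c q (P * D'%:P - P' * D%:P) =
        ev2 iota c q P * ev1 iota c D' - ev2 iota c q P' * ev1 iota c D.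
      by rewrite ev2B !ev2M !ev2C.
    rewrite ev1M.
    have := indc _ D0; have := indc _ D'0.
    move: (ev1 iota c D) (ev1 iota c D') (ev2 iota c q P) (ev2 iota c q P').
    move=> d d' u u' d0' d0.
    by field; rewrite d0 d0'.
  - move=> _ _ [P [D [D0 ->]]] [P' [D' [D'0 ->]]].
    exists (P * P'), (D * D'); rewrite mulf_neq0 //; split=> //.
    by rewrite ev2M ev1M invfM mulrACA.
have Aq : A q by exists 'X, 1; rewrite oner_neq0 rmorph1 divr1 ev2X.
have nAq : ~ A q^-1.
  move=> [P [D [D0 e]]].
  have P0 : P * 'X - D%:P != 0.
    apply: contraNneq D0 => /polyP/(_ 0%N).
    by rewrite coefB coefMX coefC /= sub0r coef0 => /eqP; rewrite oppr_eq0.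
  have := ind (swapXY (P * 'X - D%:P)); rewrite swapXY_eq0 P0 => /(_ isT)/eqP; apply.
  rewrite ev2_swapXY ev2B ev2M ev2X ev2C.
  have -> : ev2 iota c q P = q^-1 * ev1 iota c D by rewrite e divfK ?indc.
  by rewrite mulrAC mulVf // mul1r subrr.
have [V [AV nVq]] := Chevalley q0 sA Aq nAq.
exists V; split=> //; first by right.
split.
  by apply: AV; exists 'X%:P, 1; rewrite oner_neq0 rmorph1 divr1 ev2C ev1X.
move=> D D0; split; first exact: indc.
by apply: AV; exists 1, D; rewrite rmorph1 mul1r.
Qed.

(** The line with direction [q] through the point [(z, w)] is infinitely close to
    a generic isotropic line: to a line [w = const] if [b], and to a line
    [z = const] otherwise. *)
Definition near_isotropic (V : valuation_ring K) (b : bool) q z w :=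
  if b then vr_max V q^-1 /\ generic iota V (w - q^-1 ^+ 2 * z)
  else vr_max V q /\ generic iota V (z - q ^+ 2 * w).

Lemma near_isotropic_line V b q z w z' w' : q != 0 ->
  z' - q ^+ 2 * w' = z - q ^+ 2 * w ->
  near_isotropic V b q z w -> near_isotropic V b q z' w'.
Proof.
move=> q0 e; rewrite /near_isotropic; case: b; last by rewrite e.
suff -> : w' - q^-1 ^+ 2 * z' = w - q^-1 ^+ 2 * z by [].
have h x y : y - q^-1 ^+ 2 * x = - (q^-1 ^+ 2 * (x - q ^+ 2 * y)) by field.
by rewrite !h e.
Qed.

Lemma ycoordN (j : k) z w : ycoord iota (- j) w z = ycoord iota j z w.
Proof. by rewrite /ycoord rmorphN; congr (_ / 2); ring. Qed.
Lemma xcoordC (z w : K) : xcoord w z = xcoord z w.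
Proof. by rewrite /xcoord addrC. Qed.

(** The two cases of [isotropic_step] are exchanged by [z <-> w], [j <-> - j]. *)
Lemma near_isotropic_hit (V : valuation_ring K) (j : k) H1 H2 d1 d2 b q z w :
  2 != 0 :> K ->
  hdeg H1 d1 -> hdeg H2 d2 ->
  hval iota H1 d1 (2^-1) (iota j / 2) 0 != 0 ->
  hval iota H2 d2 (2^-1) (iota (- j) / 2) 0 != 0 ->
  hval iota H1 d1 (xcoord z w) (ycoord iota j z w) 1 = 0 ->
  hval iota H2 d2 (xcoord z w) (ycoord iota j z w) 1 = 0 ->
  near_isotropic V b q z w ->
  [/\ generic iota V z, generic iota V w & alg iota z w].
Proof.
move=> K2 hd1 hd2 H10 H20 H1w H2w.
have aw : alg iota z w.
  have [_ f0] := form_poly_neq0 z hd1 H10.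
  by apply: alg_root f0 _; rewrite (ev2_form_poly _ _ _ d1).
case: b => -[Mq gc]; last first.
  have Me : vr_max V (q ^+ 2) by apply: vr_maxM => //; apply: vr_max_sub.
  by have [] := isotropic_step K2 hd1 hd2 H10 H20 H1w H2w gc Me; rewrite ?subrK.
have Me : vr_max V (q^-1 ^+ 2) by apply: vr_maxM => //; apply: vr_max_sub.
have [] := @isotropic_step _ _ iota V (- j) H2 H1 d2 d1 _ _ w z K2 hd2 hd1 H20 _ _ _ gc Me.
- by rewrite opprK.
- by rewrite ycoordN xcoordC.
- by rewrite ycoordN xcoordC.
- by rewrite subrK.
by move=> gw gz _.
Qed.

Lemma near_isotropic_reflect (V : valuation_ring K) b q q' m z w :
  q != 0 -> m != 0 -> generic iota V z -> generic iota V w ->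
  V m -> V m^-1 -> q' = m / q ->
  near_isotropic V b q z w -> near_isotropic V (~~ b) q' z w.
Proof.
move=> q0 m0 gz gw Vm Vmi ->.
have Vz := gz.1; have Vw := gw.1.
case: b => -[Mq _] /=.
  have Mq' : vr_max V (m / q) by apply: vr_maxM.
  split=> //; apply: generic_near gz _; rewrite addrC addKr; apply: vr_maxN.
  by rewrite mulrC; apply: vr_maxM => //; apply: vr_maxM => //; apply: vr_max_sub.
have Mq' : vr_max V (m / q)^-1 by rewrite invf_div mulrC; apply: vr_maxM.
split=> //; apply: generic_near gw _; rewrite addrC addKr; apply: vr_maxN.
by rewrite mulrC; apply: vr_maxM => //; apply: vr_maxM => //; apply: vr_max_sub.
Qed.

End Place.

(** * The real plane in isotropic coordinates *)

Section Real.
Variable R : realType.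
Local Notation C := R[i].

Lemma limit_point_bigcup n (G : 'I_n -> set (R * R)) a :
  limit_point (\bigcup_i G i) a -> exists i, limit_point (G i) a.
Proof.
move=> la; apply: contrapT => /forallNP nl.
have h : \forall y \near nbhs a, forall i, y != a -> ~ G i y.
  apply: filter_forall => i; have := nl i; rewrite /limit_point /=.
  move=> /existsNP[U /not_implyP[nU hU]]; apply: filterS nU => y Uy ya Gy.
  by apply: hU; exists y.
have [y [ya [i _ Gy] hy]] := la _ h.
exact: hy ya Gy.
Qed.

Lemma limit_tangent (S G : set (R * R)) a tau : G `<=` S ->
  (fun p => cross (p - a) tau / `|p - a|) @ within S a^' --> (0 : R) ->
  (fun p => cross (p - a) tau / `|p - a|) @ within G a^' --> (0 : R).
Proof.
move=> GS; apply: cvg_trans; apply: cvg_app => P.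
have FF : Filter (a^') by exact: dnbhs_filter.
rewrite /within /= => hP; apply: (@filterS _ _ FF _ _ _ hP) => p hp /GS.
exact: hp.
Qed.

Lemma zcD (p p' : R * R) : zc (p + p') = zc p + zc p'.
Proof. by []. Qed.
Lemma wcD (p p' : R * R) : wc (p + p') = wc p + wc p'.
Proof. by apply/eqP; rewrite eq_complex /= opprD !eqxx. Qed.
Lemma zcZ (t : R) (p : R * R) : zc (t *: p) = t%:C%C * zc p.
Proof. by apply/eqP; rewrite eq_complex /= !mul0r subr0 addr0 !eqxx. Qed.
Lemma wcZ (t : R) (p : R * R) : wc (t *: p) = t%:C%C * wc p.
Proof. by apply/eqP; rewrite eq_complex /= !mul0r subr0 addr0 mulrN !eqxx. Qed.

Lemma zc_neq0 (p : R * R) : p != 0 -> zc p != 0.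
Proof.
apply: contraNneq => /eqP; rewrite eq_complex /= => /andP[/eqP e1 /eqP e2].
by case: p e1 e2 => x y /= -> ->.
Qed.
Lemma wc_neq0 (p : R * R) : p != 0 -> wc p != 0.
Proof.
apply: contraNneq => /eqP; rewrite eq_complex /= oppr_eq0 => /andP[/eqP e1 /eqP e2].
by case: p e1 e2 => x y /= -> ->.
Qed.

Lemma zc_wc (u : R * R) : zc u * wc u = (dot u u)%:C%C.
Proof. by apply/eqP; rewrite eq_complex /dot /=; apply/andP; split; apply/eqP; ring. Qed.

Lemma wc_unit (u : R * R) : dot u u = 1 -> zc u != 0 /\ wc u = (zc u)^-1.
Proof.
move=> u1; have e := zc_wc u; rewrite u1 in e.
have z0 : zc u != 0.
  by apply/eqP => z0; move/eqP: e; rewrite z0 mul0r eq_sym oner_eq0.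
by split=> //; rewrite -[LHS](mulKf z0) e mulr1.
Qed.

Lemma mirror_unit (tau u : R * R) : tau != 0 -> dot u u = 1 ->
  dot (mirror tau u) (mirror tau u) = 1 /\ zc (mirror tau u) = (zc tau / wc tau) / zc u.
Proof.
move=> t0 u1.
have z0 := zc_neq0 t0; have w0 := wc_neq0 t0.
have dt : dot tau tau != 0.
  by apply: contraNneq (mulf_neq0 z0 w0) => e; rewrite zc_wc e.
split.
  rewrite -u1 /mirror; move: dt; rewrite /dot /= /GRing.scale /= => dt; field.
  exact: dt.
have [u0 eu] := wc_unit u1.
rewrite -eu /mirror zcD zcZ.
have -> : zc (- u) = - zc u by [].
have e1 : (2 * dot u tau)%:C%C = zc u * wc tau + wc u * zc tau.
  by apply/eqP; rewrite eq_complex /dot /=; apply/andP; split; apply/eqP; ring.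
have -> : (2 * dot u tau / dot tau tau)%:C%C =
    (zc u * wc tau + wc u * zc tau) / (zc tau * wc tau).
  by rewrite rmorphM fmorphV /= -e1 zc_wc.
by field; rewrite z0 w0.
Qed.

Lemma xcoord_zc (p : R * R) : xcoord (zc p) (wc p) = (p.1)%:C%C.
Proof.
rewrite /xcoord; apply: (mulIf (_ : 2 != 0)); first by rewrite pnatr_eq0.
rewrite divfK ?pnatr_eq0 //; apply/eqP; rewrite eq_complex /=.
by apply/andP; split; apply/eqP; ring.
Qed.

Lemma ycoord_zc (k : fieldType) (iota : {rmorphism k -> C}) (j : k) (p : R * R) :
  iota j = 'i%C -> ycoord iota j (zc p) (wc p) = (p.2)%:C%C.
Proof.
move=> ej; rewrite /ycoord ej; apply: (mulIf (_ : 2 != 0)); first by rewrite pnatr_eq0.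
rewrite divfK ?pnatr_eq0 //; apply/eqP; rewrite eq_complex /=.
by apply/andP; split; apply/eqP; ring.
Qed.

Lemma form_of_mpoly d (F : mpoly 3 C) : F \is mpoly.ishomog1 d (@mpoly.mdeg 3) ->
  exists H : hform C, hdeg H d /\ forall z : 3.-tuple C,
    mpoly.meval (tnth z) F =
    hval idfun H d (tnth z (inord 0)) (tnth z (inord 1)) (tnth z (inord 2)).
Proof.
move=> hF.
exists [seq (mpoly.mcoeff m F, (m (inord 0), m (inord 1)))
       | m : mpoly.multinom 3 <- mpoly.msupp F].
have deg3 (m : mpoly.multinom 3) : m \in mpoly.msupp F ->
    (m (inord 0) + m (inord 1) + m (inord 2) = d)%N.
  move=> /(allP hF) /= /eqP <-; rewrite mpoly.mdegE !big_ord_recr big_ord0 /= add0n.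
  by congr (m _ + m _ + m _)%N; apply/val_inj; rewrite /= inordK.
split.
  rewrite /hdeg all_map; apply/allP => m /deg3 /= <-; exact: leq_addr.
move=> z; rewrite mpoly.mevalE /hval [RHS]big_map. apply: eq_big_seq => m hm /=.
congr (_ * _); rewrite !big_ord_recr big_ord0 /= mul1r -(deg3 m hm) addKn.
by congr (_ ^+ (m _) * _ ^+ (m _) * _ ^+ (m _)); try congr (tnth _ _);
  apply/val_inj; rewrite /= inordK.
Qed.

End Real.

(** * Odd orbits *)

Section Final.
Variable R : realType.
Local Notation C := R[i].

Definition vanishes (k : fieldType) (iota : {rmorphism k -> C}) (H : hform k) d
    (G : set (R * R)) :=
  forall p, G p -> hval iota H d (p.1)%:C%C (p.2)%:C%C 1 = 0.

Lemma form_avoiding (G : set (R * R)) (s : C) :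
  ~ complexification G [tuple 1; s; 0] ->
  exists d (H : hform C), [/\ hdeg H d, vanishes idfun H d G & hval idfun H d 1 s 0 != 0].
Proof.
move=> /not_andP[|].
  by case; exists (inord 0); rewrite (tnth_nth 0) /= inordK // oner_neq0.
move=> /existsNP[d /existsNP[F /not_implyP[hF /not_implyP[FG F0]]]].
have [H [hd eH]] := form_of_mpoly hF.
exists d, H; split=> // [p Gp|].
  by have := FG p Gp; rewrite eH !(tnth_nth 0) /= !inordK.
by move/eqP: F0; rewrite eH !(tnth_nth 0) /= !inordK.
Qed.

Lemma lift_form (k : subfield C) (H0 : hform C) :
  (forall h, h \in H0 -> k h.1) ->
  exists H : hform (sf_type k),
    (forall d, hdeg H d = hdeg H0 d) /\
    (forall d x y t, hval (sf_emb k) H d x y t = hval idfun H0 d x y t).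
Proof.
elim: H0 => [|[u nm] H0 IH] hk.
  by exists [::]; split=> // d x y t; rewrite /hval !big_nil.
have [h hh|H [e1 e2]] := IH; first by apply: hk; rewrite inE hh orbT.
have [u' eu] := sf_lift (hk (u, nm) (mem_head _ _)).
exists ((u', nm) :: H); split=> [d|d x y t]; first by rewrite /= e1.
by rewrite /hval !big_cons /= eu; congr (_ + _); exact: e2.
Qed.

Lemma hval_half (k : fieldType) (iota : {rmorphism k -> C}) (H : hform k) d s :
  hdeg H d ->
  hval iota H d 1 s 0 != 0 -> hval iota H d (2^-1) (s / 2) 0 != 0.
Proof.
move=> hd h0; have := hval_scale iota 2^-1 1 s 0 hd.
rewrite mulr1 mulr0 [2^-1 * s]mulrC => ->.
by rewrite mulf_neq0 // expf_neq0 // invr_eq0 pnatr_eq0.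
Qed.

(** The slope in isotropic coordinates is [- Q_w / Q_z] for the polynomial [Q] of
    [min_relation], hence algebraic over [k(z)].  For a real tangent vector
    neither coordinate is zero, so that [Q_w] being nonzero at the point implies
    the same for [Q_z]. *)
Lemma tangent_slope_unit (k : fieldType) (iota : {rmorphism k -> C})
    (V : valuation_ring C) (j : k) (H : hform k) d (G : set (R * R)) a tau :
  iota j = 'i%C -> hdeg H d -> hval iota H d (2^-1) (iota j / 2) 0 != 0 ->
  vanishes iota H d G -> limit_point G a -> tau != 0 ->
  (fun p => cross (p - a) tau / `|p - a|) @ within G a^' --> (0 : R) ->
  generic iota V (zc a) -> alg iota (zc a) (wc a) ->
  V (zc tau / wc tau) /\ V (zc tau / wc tau)^-1.
Proof.
move=> ej hd H0 HG la t0 tgt gz aw.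
have PF := limit_point_proper la.
have [f0 _] := form_poly_neq0 (zc a) hd H0.
set f := form_poly j H in f0.
have fG p : G p -> ev2 iota (zc p) (wc p) f = 0.
  by move=> Gp; rewrite (ev2_form_poly _ _ _ d) xcoord_zc (ycoord_zc _ ej); apply: HG.
have nearf : \forall p \near within G a^', ev2 iota (zc p) (wc p) f = 0.
  by apply: filterS (near_withinT _ _) => p /fG.
have fa := zero_at_limit_point la nearf.
have ch0 : [pchar k] =i pred0.
  by move=> p; rewrite -(fmorph_pchar iota) pchar_num.
have [Q [E [r [P [Qa dQ Pa e]]]]] := min_relation (generic_transcendental gz) ch0 f0 fa.
have nearQ : \forall p \near within G a^', ev2 iota (zc p) (wc p) Q = 0.
  apply: filterS2 nearf (near_neq0 G Pa) => p fp Pp.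
  have := congr1 (ev2 iota (zc p) (wc p)) e.
  rewrite ev2Z fp mulr0 ev2M rmorphXn /= => /esym/eqP.
  by rewrite mulf_eq0 (negPf Pp) orbF expf_eq0 => /andP[_ /eqP].
have grad := tangent_gradient la tgt nearQ.
have z0 := zc_neq0 t0; have w0 := wc_neq0 t0.
set Qz := ev2 iota _ _ (map_poly deriv Q) in grad.
set Qw := ev2 iota _ _ (Q^`()) in grad dQ.
have Qz0 : Qz != 0.
  apply: contraNneq (mulf_neq0 dQ w0) => e0.
  by move: grad; rewrite e0 mul0r add0r => ->.
have -> : zc tau / wc tau = - Qw / Qz.
  apply/eqP; rewrite eqr_div // mulNr -addr_eq0 mulrC -grad; apply/eqP.
  by [].
have am : alg iota (zc a) (- Qw / Qz).
  by apply: integral_div; [apply: integral_opp|]; apply: alg_ev2.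
by split; [exact: alg_V gz am|exact: alg_invV gz am].
Qed.

Lemma line_shift (p u : R * R) t : dot u u = 1 ->
  zc (p + t *: u) - zc u ^+ 2 * wc (p + t *: u) = zc p - zc u ^+ 2 * wc p.
Proof.
move=> /wc_unit[u0 eu]; rewrite zcD wcD zcZ wcZ eu; field.
by [].
Qed.

Lemma line_base_c (l : R * R) :
  zc (line_base l) - line_q l ^+ 2 * wc (line_base l) = line_c l.
Proof.
have u1 : dot (line_dir l) (line_dir l) = 1.
  by rewrite /dot /= -!expr2 cos2Dsin2.
have [q0 eq] := wc_unit u1.
have e1 : zc (line_base l) = Complex 0 l.2 * line_q l.
  by apply/eqP; rewrite eq_complex /=; apply/andP; split; apply/eqP; ring.
have e2 : wc (line_base l) = - (Complex 0 l.2 * wc (line_dir l)).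
  by apply/eqP; rewrite eq_complex /=; apply/andP; split; apply/eqP; ring.
rewrite e1 e2 eq /line_c /line_q.
have -> : Complex 0 (2 * l.2) = 2 * Complex 0 l.2.
  by apply/eqP; rewrite eq_complex /=; apply/andP; split; apply/eqP; ring.
by field.
Qed.

(** The direction [q] is infinitely small at first, and infinitely large after an
    odd number of reflections. *)
Theorem odd_orbit_not_closed (k : subfield C) (V : valuation_ring C) (j : sf_type k)
   n (G : 'I_n -> set (R * R)) (H1 H2 : 'I_n -> hform (sf_type k)) (d1 d2 : 'I_n -> nat)
   l K a u :
  let iota := sf_emb k in
  iota j = 'i%C ->
  (forall i, [/\ hdeg (H1 i) (d1 i), vanishes iota (H1 i) (d1 i) (G i)
     & hval iota (H1 i) (d1 i) (2^-1) ('i%C / 2) 0 != 0]) ->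
  (forall i, [/\ hdeg (H2 i) (d2 i), vanishes iota (H2 i) (d2 i) (G i)
     & hval iota (H2 i) (d2 i) (2^-1) (- 'i%C / 2) 0 != 0]) ->
  vr_max V (line_q l) -> generic iota V (line_c l) ->
  odd K -> billiard_orbit (\bigcup_i G i) K l a u -> u K <> line_dir l.
Proof.
move=> iota ej h1 h2 Mq gc oK [u0 [t0 [a0 _ _]] refl nexth] uK.
have C2 : 2 != 0 :> C by rewrite pnatr_eq0.
have dir1 : dot (line_dir l) (line_dir l) = 1 by rewrite /dot /= -!expr2 cos2Dsin2.
have step i : (i < K)%N -> dot (u i) (u i) = 1 ->
    near_isotropic iota V (odd i) (zc (u i)) (zc (a i)) (wc (a i)) ->
    dot (u i.+1) (u i.+1) = 1 /\
    near_isotropic iota V (odd i.+1) (zc (u i.+1)) (zc (a i)) (wc (a i)).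
  move=> iK ui st.
  have [tau [tau0 la tgt] eu] := refl i iK.
  have [v1 v2] := mirror_unit tau0 ui; rewrite -eu in v1 v2.
  split=> //.
  have [g lg] := limit_point_bigcup la.
  have tgtG : (fun p => cross (p - a i) tau / `|p - a i|)
      @ within (G g) (a i)^' --> (0 : R).
    by apply: limit_tangent tgt => p Gp; exists g.
  have [hd1 van1 top1] := h1 g; have [hd2 van2 top2] := h2 g.
  have vanA H d : vanishes iota H d (G g) ->
      hval iota H d (xcoord (zc (a i)) (wc (a i)))
        (ycoord iota j (zc (a i)) (wc (a i))) 1 = 0.
    move=> van; rewrite -(ev2_form_poly iota j H d).
    apply: (zero_at_limit_point lg).
    have PF := limit_point_proper lg.
    apply: filterS (near_withinT _ _) => p Gp.
    by rewrite (ev2_form_poly _ _ _ d) xcoord_zc (ycoord_zc _ ej); apply: van.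
  rewrite -ej in top1; rewrite -ej -rmorphN in top2.
  have [gz gw aw] := near_isotropic_hit C2 hd1 hd2 top1 top2
    (vanA _ _ van1) (vanA _ _ van2) st.
  have [Vm Vmi] := tangent_slope_unit ej hd1 top1 van1 lg tau0 tgtG gz aw.
  have m0 : zc tau / wc tau != 0 by rewrite mulf_neq0 ?invr_eq0 ?zc_neq0 ?wc_neq0.
  have [q0 _] := wc_unit ui.
  exact: (near_isotropic_reflect q0 m0 gz gw Vm Vmi v2 st).
have inv i : (i < K)%N -> dot (u i) (u i) = 1 /\
    near_isotropic iota V (odd i) (zc (u i)) (zc (a i)) (wc (a i)).
  elim: i => [_|i IH iK].
    rewrite u0 a0 u0; split=> //=; rewrite line_shift //.
    by rewrite -/(line_q l) line_base_c.
  have [ui st] := IH (ltnW iK).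
  have [ui1 st1] := step i (ltnW iK) ui st.
  split=> //.
  have [t [_ -> _ _]] := nexth i iK.
  have [q0 _] := wc_unit ui1.
  by apply: near_isotropic_line st1 => //; rewrite line_shift.
have K0 : (0 < K)%N by case: K oK {refl nexth uK step inv}.
have lastK : (K.-1 < K)%N by rewrite prednK.
have [ui st] := inv _ lastK.
have [_] := step _ lastK ui st; rewrite prednK //.
rewrite oK uK /near_isotropic -/(line_q l) => -[Mqi _].
apply: (@vr_max1 _ V); rewrite -(mulfV (line_q_neq0 l)).
by apply: vr_maxM => //; apply: vr_max_sub.
Qed.
End Final.

Theorem corollary1p21 (R : realType) (B : set (R * R)) (n : nat)
    (G : 'I_n -> set (R * R)) (k : nat)
    (B_closed : closed B) (B_bounded : bounded_set B)
    (G_arc : forall i, algebraic_arc (G i))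
    (B_boundary : boundary B = \bigcup_i G i)
    (no_isotropic : forall i,
       ~ complexification (G i) (isotropic1 R) /\
       ~ complexification (G i) (isotropic2 R))
    (k_odd : odd k) :
  ~ k_reflective k B.
Proof.
move=> pos; apply: pos.
have /choice[D1 hD1] : forall i, exists dH : nat * hform R[i],
   [/\ hdeg dH.2 dH.1, vanishes idfun dH.2 dH.1 (G i) &
       hval idfun dH.2 dH.1 1 'i%C 0 != 0].
  by move=> i; have [/form_avoiding[d [H hH]] _] := no_isotropic i; exists (d, H).
have /choice[D2 hD2] : forall i, exists dH : nat * hform R[i],
   [/\ hdeg dH.2 dH.1, vanishes idfun dH.2 dH.1 (G i) &
       hval idfun dH.2 dH.1 1 (- 'i%C) 0 != 0].
  by move=> i; have [_ /form_avoiding[d [H hH]]] := no_isotropic i; exists (d, H).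
pose coeffs : set R[i] := [set 'i%C] `|`
  \bigcup_i [set` [seq h.1 | h <- (D1 i).2 ++ (D2 i).2]].
have cc : countable coeffs.
  apply: countable_setU; first exact: countable1.
  apply: bigcup_countable => // i _; apply: finite_set_countable.
  exact: finite_seq.
have [F [cF SF]] := countable_subfield cc.
have [j ej] := sf_lift (SF 'i%C (or_introl erefl)).
have lift1 i : exists H : hform (sf_type F), 
    (forall d, hdeg H d = hdeg (D1 i).2 d) /\
    (forall d x y t, hval (sf_emb F) H d x y t = hval idfun (D1 i).2 d x y t).
  apply: lift_form => h hh; apply: SF; right; exists i => //=.
  by rewrite map_f // mem_cat hh.
have lift2 i : exists H : hform (sf_type F), 
    (forall d, hdeg H d = hdeg (D2 i).2 d) /\
    (forall d x y t, hval (sf_emb F) H d x y t = hval idfun (D2 i).2 d x y t).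
  apply: lift_form => h hh; apply: SF; right; exists i => //=.
  by rewrite map_f // mem_cat hh orbT.
have [H1 hH1] := choice lift1; have [H2 hH2] := choice lift2.
have [N [mN N0 sub]] := generic_line (sf_emb F) cF; exists N; split=> //.
move=> l [ol [k0 [a [u [orb [uk _] _]]]]].
apply: sub; split=> // ind.
have [V [q0 Mq gc]] := generic_place ind.
rewrite B_boundary in orb.
apply: (odd_orbit_not_closed (H1 := H1) (H2 := H2) (d1 := fun i => (D1 i).1)
  (d2 := fun i => (D2 i).1) ej _ _ Mq gc k_odd orb uk) => i.
  have [h1 h2 h3] := hD1 i; have [e1 e2] := hH1 i.
  split; [by rewrite e1|by move=> p Gp; rewrite e2; apply: h2|].
  by apply: hval_half; rewrite ?e1 ?e2.
have [h1 h2 h3] := hD2 i; have [e1 e2] := hH2 i.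
split; [by rewrite e1|by move=> p Gp; rewrite e2; apply: h2|].
by apply: hval_half; rewrite ?e1 ?e2.
Qed.
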